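(* Let $\mathfrak{U}$ be the class of all finite supersoluble groups, let $\mathfrak{F}$ be an $S$-closed saturated formation of finite groups containing $\mathfrak{U}$, and let $H$ be a normal subgroup of a finite group $G$ such that $G/H\in\mathfrak{F}$. Suppose that every maximal subgroup of every non-cyclic Sylow subgroup of $F^{*}(H)$ having no supersoluble supplement in $G$ is $\mathfrak{U}_{\mathrm s}$-quasinormal in $G$. Then $G\in\mathfrak{F}$.
   Context: All groups are finite. A class $\mathfrak{F}$ of finite groups is a formation if it is closed under homomorphic images and every group $G$ has a smallest normal subgroup whose quotient lies in $\mathfrak{F}$. It is saturated if it contains every group $G$ with $G/\Phi(G)\in\mathfrak{F}$, where $\Phi(G)$ is the Frattini subgroup, and $S$-closed if it contains all subgroups of all its groups. $F^{*}(H)$ denotes the generalized Fitting subgroup of $H$, the product of all normal quasinilpotent subgroups of $H$. A subgroup $M$ of $G$ has a supersoluble supplement in $G$ if there is a supersoluble subgroup $T$ of $G$ with $G=MT$. The condition ''having no supersoluble supplement in $G$'' in the claim refers to the maximal subgroups of the Sylow subgroups. A subgroup $H$ of $G$ is $s$-permutable in $G$ if $HQ=QH$ for every Sylow subgroup $Q$ of $G$ (for every prime). $H_G$ denotes the largest normal subgroup of $G$ contained in $H$. A chief factor $H/K$ of $G$ is $\mathfrak{U}$-central if the semidirect product $[H/K](G/C_G(H/K))$ (with $G/C_G(H/K)$ acting on $H/K$ by conjugation) belongs to $\mathfrak{U}$. The $\mathfrak{U}$-hypercenter $Z_\infty^{\mathfrak{U}}(G)$ is the product of all normal subgroups $N$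 of $G$ such that every $G$-chief factor of $N$ (i.e. every chief factor of $G$ below $N$) is $\mathfrak{U}$-central. A subgroup $H$ of $G$ is $\mathfrak{U}_{\mathrm s}$-quasinormal in $G$ if there exists a normal subgroup $T$ of $G$ such that $HT$ is $s$-permutable in $G$ and $(H\cap T)H_G/H_G\leq Z_\infty^{\mathfrak{U}}(G/H_G)$. *)

(* Defs.v *)
From mathcomp Require Import all_boot all_fingroup all_solvable.
From mathcomp Require Import boolp.

Set Implicit Arguments.
Unset Strict Implicit.
Unset Printing Implicit Defensive.

Import GroupScope.

(* Closure under isomorphism is not built in: it follows from closure under
   homomorphic images. *)
Definition group_class := forall gT : finGroupType, {group gT} -> Prop.

Definition hom_closed (F : group_class) : Prop :=
  forall (aT rT : finGroupType) (G : {group aT}) (f : {morphism G >-> rT}),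
    F aT G -> F rT (f @* G)%G.

Definition has_residuals (F : group_class) : Prop :=
  forall (gT : finGroupType) (G : {group gT}),
    exists N : {group gT},
      [/\ N <| G, F _ (G / N)%G
        & forall M : {group gT}, M <| G -> F _ (G / M)%G -> N \subset M].

Definition formation (F : group_class) : Prop :=
  hom_closed F /\ has_residuals F.

Definition saturated (F : group_class) : Prop :=
  forall (gT : finGroupType) (G : {group gT}), F _ (G / 'Phi(G))%G -> F gT G.

Definition S_closed (F : group_class) : Prop :=
  forall (gT : finGroupType) (G K : {group gT}), K \subset G -> F gT G -> F gT K.

(* G has a finite series, from 1 to G, of normal subgroups of G with cyclic
   factors. *)
Definition supersoluble : group_class := fun gT G =>
  exists2 s : seq {group gT},
    path (fun K L : {group gT} => [&& K \subset L, L <| G & cyclic (L / K)])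
         1%G s
    & last 1%G s = G.

Definition class_sub (F1 F2 : group_class) : Prop :=
  forall (gT : finGroupType) (G : {group gT}), F1 gT G -> F2 gT G.

Section ChiefFactors.

Variables (gT : finGroupType) (G K H : {group gT}).

(* [chief_factor G K H] says that H / K is a chief factor of G: the bottom
   of the factor comes first. *)
Lemma chief_factor_acts :
  chief_factor G K H -> {acts G, on group H / K | 'Q}.
Proof.
case/andP=> /maxgroupp/andP[_ nKG] nsHG; split; last by rewrite quotientS ?subsetT.
by apply: actsQ => //; apply: normal_norm.
Qed.

Hypothesis chHK : chief_factor G K H.

(* The conjugation action of G / C_G(H / K) on H / K. *)
Definition chief_gact :=
  (<[chief_factor_acts chHK]> %% 'C_G((H / K)%g | 'Q)%g)%gact.

(* [chief_gact] is declared on the fixed points of C_G(H / K) in H / K, which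
   are the whole of H / K. *)
Lemma chief_gact_range : gact_range chief_gact = H / K.
Proof.
rewrite /gact_range gacent_actby gacentQ; apply/setIidPl.
rewrite centsC (subset_trans (quotientS K (subsetIr _ _))) //.
by rewrite (subset_trans (quotientS K (subsetIr _ _))) // quotient_astabQ.
Qed.

Definition U_central : Prop := supersoluble [set: sdprod_by chief_gact]%G.

End ChiefFactors.

Section Hypercenters.

Variables (gT : finGroupType) (G : {group gT}).

Definition U_hypercentral (N : {group gT}) : Prop :=
  forall (K H : {group gT}) (chHK : chief_factor G K H),
    H \subset N -> U_central chHK.

(* In Group_scope the product is the join, which for normal subgroups is the
   set product. *)
Definition U_hypercenter : {group gT} :=
  (\prod_(N : {group gT} | (N <| G) && `[< U_hypercentral N >]) N)%G.

(* Every element of G induces an inner automorphism on every chief factor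
   of G. *)
Definition quasinilpotent : Prop :=
  forall K H : {group gT}, chief_factor G K H ->
    forall g, g \in G ->
      exists2 h, h \in H
        & {in H / K, forall u, u ^ coset K g = u ^ coset K h}.

End Hypercenters.

Definition generalized_Fitting (gT : finGroupType) (G : {group gT}) :
    {group gT} :=
  (\prod_(N : {group gT} | (N <| G) && `[< quasinilpotent N >]) N)%G.

Notation "''F*' ( G )" := (generalized_Fitting G)
  (at level 0, format "''F*' ( G )") : Group_scope.

Section Subgroups.

Variables (gT : finGroupType) (G : {group gT}).

Definition s_permutable (A : {set gT}) : Prop :=
  forall (p : nat) (Q : {group gT}), prime p -> p.-Sylow(G) Q -> A * Q = Q * A.

Definition has_supersoluble_supplement (M : {group gT}) : Prop :=
  exists T : {group gT}, [/\ T \subset G, supersoluble T & M * T = G].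

(* [gcore H G] is the largest normal subgroup of G contained in H. *)
Definition Us_quasinormal (H : {group gT}) : Prop :=
  exists T : {group gT},
    [/\ T <| G, s_permutable (H * T)
      & (H :&: T) * gcore H G / gcore H G
          \subset U_hypercenter (G / gcore H G)].

End Subgroups.

(* Main.v *)
Require Import Defs.
From mathcomp Require Import all_boot all_fingroup all_solvable.
From mathcomp Require Import all_algebra finfield mxrepresentation mxabelem.
From mathcomp Require Import boolp.

Set Implicit Arguments.
Unset Strict Implicit.
Unset Printing Implicit Defensive.

Import GroupScope.

(** Everything is decided by chains of normal subgroups of G with cyclic
    factors; a normal subgroup reached from 1 by such a chain is called
    hypercyclically embedded here. If H is one and G / H lies in the saturated
    formation F, then so does G
    ([saturated_formation_hypercyclic_extension]): a normal subgroup N of prime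
    order either lies in the Frattini subgroup or has a complement M, and in the
    second case G is a subdirect product of G / N and of the supersoluble group
    G / C_M(N). Moreover it is enough that the chain reaches X = F*(H), once X is
    known to be nilpotent ([hypercyclic_Fitting_extension]): the derived
    subgroup G' centralises every cyclic factor, which makes the intersection of
    H with G' nilpotent, hence contained in F(H) = X, so that H / X is central
    in G / X. The extension step uses C_H(X) <= X, which holds for the
    generalized Fitting subgroup of every finite group
    ([cent_generalized_Fitting]).

    What remains is to extract from the hypothesis on maximal subgroups that X
    is soluble, so that F*(H) = F(H) is nilpotent, and that each Sylow subgroup
    of this nilpotent X is hypercyclically embedded.

    Both arguments rest on a trichotomy for a maximal subgroup M of a Sylow
    p-subgroup P of X. Either M has a supersoluble supplement T in G; or M is
    quasinormal through some normal subgroup T of G, and then either P meets T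
    inside M, in which case M T is normalised by O^p(G)
    ([s_permutable_residual_norm]), or P does not, and the part of T inside M
    belongs to the inverse image of a hypercenter ([Us_quasinormal_cases]).

    For solubility, p is taken to be the smallest prime divisor of |X|; it is
    shown that X has a normal p-complement ([p_nilpotence_criterion]), which
    again satisfies the hypothesis, and induction applies. A supersoluble
    supplement of M yields a Hall p'-subgroup K of X with a Sylow tower such that
    N_P(K) is not inside M ([supplement_Hall]), and Hall subgroups with Sylow
    towers are conjugate ([Sylow_tower_Hall_trans]). A product M T normalised by
    O^p(G) forces P :&: O^p(X) into M ([Sylow_residual_maximal]); if that
    happens for every M, then P :&: O^p(X) lies in Phi(P), and X is p-nilpotent
    by the theorem of Tate ([Tate]), whose proof here goes through the splitting
    theorem of Gaschuetz. The quasinormal case that remains is confined by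
    minimal normal subgroups.

    For a normal p-subgroup P of G ([normal_pgroup_hypercyclic]), a chain from
    Phi(P) to P can be replaced by one from 1 to P ([hypercyclic_Phi_lift]),
    which reduces the problem to elementary abelian P. If the bottom of P were a
    noncyclic minimal normal subgroup N of G, every nontrivial normal subgroup of
    G inside P would contain N. A line of N fixed by a Sylow p-subgroup of G is
    moved by some x in O^p(G); a maximal subgroup of P that contains the line
    but not its image under x then contradicts all three cases at once
    ([no_noncyclic_minnormal]). *)

(** * Chains of normal subgroups with cyclic factors *)

(** Chains are pushed through joins, images and inverse images, where the
    factors are not computed easily; a generator modulo B survives all of these. *)
Lemma cyclic_quotientP (gT : finGroupType) (B L : {group gT}) :
  B <| L ->
  reflect (exists2 x, x \in L & L \subset B <*> <[x]>) (cyclic (L / B)).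
Proof.
case/andP=> sBL nBL; apply: (iffP cyclicP) => [[xB defLB] | ].
  have: xB \in L / B by rewrite defLB cycle_id.
  case/morphimP=> x nBx Lx def_xB; exists x => //.
  rewrite norm_joinEr ?cycle_subG // -quotientSK //.
  by rewrite defLB def_xB -quotient_cycle.
case=> x Lx sLBx; exists (coset B x); rewrite -quotient_cycle ?(subsetP nBL) //.
apply/eqP; rewrite eqEsubset; apply/andP; split; last first.
  by rewrite quotientS ?cycle_subG.
by rewrite -(quotientYidl (G := <[x]>)) ?quotientS // cycle_subG (subsetP nBL).
Qed.

(** The chain starts at an arbitrary A, so that pieces of chains can be
    concatenated and lifted from quotients; only its terms above A have to be
    normal in G. *)
Inductive hypercyclic (gT : finGroupType) (G A : {group gT}) :
    {group gT} -> Prop :=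
  | hypercyclic_refl : hypercyclic G A A
  | hypercyclic_step (B L : {group gT}) :
      hypercyclic G A B -> B \subset L -> L <| G -> cyclic (L / B) ->
    hypercyclic G A L.

Section Hypercyclic.

Variable gT : finGroupType.
Implicit Types G A B C H K L M N Y Z W : {group gT}.

Lemma hypercyclic_sub G A B : hypercyclic G A B -> A \subset B.
Proof. by elim=> // B1 L _ sAB sBL _ _; apply: subset_trans sBL. Qed.

Lemma hypercyclic_normal G A B : A <| G -> hypercyclic G A B -> B <| G.
Proof. by move=> nsAG []. Qed.

Lemma hypercyclic_trans G A B C :
  hypercyclic G A B -> hypercyclic G B C -> hypercyclic G A C.
Proof.
by move=> hAB; elim=> // D L _ hAD sDL nsLG; apply: hypercyclic_step hAD _ _.
Qed.

Lemma hypercyclic_join G A B C : A <| G -> C <| G ->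
  hypercyclic G A B -> hypercyclic G (A <*> C)%G (B <*> C)%G.
Proof.
move=> nsAG nsCG; elim=> [|{}B L hAB IH sBL nsLG cycLB].
  exact: hypercyclic_refl.
have nsBG := hypercyclic_normal nsAG hAB.
apply: (hypercyclic_step IH); rewrite ?normalY ?genS ?setSU //.
have nsBL : B <| L := normalS sBL (normal_sub nsLG) nsBG.
have [x Lx sLBx] := cyclic_quotientP nsBL cycLB.
apply/cyclic_quotientP.
  apply: normalS (normalY nsBG nsCG); first by rewrite genS ?setSU.
  by rewrite normal_sub ?normalY.
exists x; first by apply: subsetP Lx; rewrite joing_subl.
rewrite join_subG; apply/andP; split.
  by apply: subset_trans sLBx _; rewrite genS ?setSU ?joing_subl.
by rewrite (subset_trans (joing_subr B C)) ?joing_subl.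
Qed.

(** By the second isomorphism theorem the factors of the chain cut down to Y
    embed in the original ones. The acting group may shrink from G to K. *)
Lemma hypercyclic_setI G K A B Y : A <| G -> K \subset G -> Y <| K ->
  hypercyclic G A B -> hypercyclic K (A :&: Y)%G (B :&: Y)%G.
Proof.
move=> nsAG sKG nsYK; have sYG := subset_trans (normal_sub nsYK) sKG.
elim=> [|{}B L hAB IH sBL nsLG cycLB].
  exact: hypercyclic_refl.
have /andP[_ nBG] := hypercyclic_normal nsAG hAB.
apply: (hypercyclic_step IH); rewrite ?setSI //=.
  rewrite /normal subIset ?(normal_sub nsYK) ?orbT //=.
  exact: normsI (subset_trans sKG (normal_norm nsLG)) (normal_norm nsYK).
have nBLY : L :&: Y \subset 'N(B) by rewrite subIset // (subset_trans sYG) ?orbT.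
have -> : B :&: Y = B :&: (L :&: Y) by rewrite setIA (setIidPl sBL).
rewrite (isog_cyclic (second_isog nBLY)) /=.
by rewrite (cyclicS _ cycLB) // quotientS // subsetIl.
Qed.

Lemma hypercyclic_quotient G A B N : A <| G -> G \subset 'N(N) ->
  hypercyclic G A B -> hypercyclic (G / N)%G (A / N)%G (B / N)%G.
Proof.
move=> nsAG nNG; elim=> [|{}B L hAB IH sBL nsLG cycLB].
  exact: hypercyclic_refl.
have nsBL := normalS sBL (normal_sub nsLG) (hypercyclic_normal nsAG hAB).
apply: (hypercyclic_step IH); rewrite ?quotientS ?quotient_normal //.
have [x Lx sLBx] := cyclic_quotientP nsBL cycLB.
have nNL := subset_trans (normal_sub nsLG) nNG.
have nNx : <[x]> \subset 'N(N) by rewrite cycle_subG (subsetP nNL).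
apply/cyclic_quotientP; first exact: quotient_normal.
exists (coset N x); first exact: mem_quotient.
rewrite -quotient_cycle -?cycle_subG // -quotientY ?quotientS //.
exact: subset_trans (normal_sub nsBL) nNL.
Qed.

End Hypercyclic.

Section HypercyclicTransfer.

Variable gT : finGroupType.
Implicit Types G A B C H K L M N Y Z W : {group gT}.

Lemma hypercyclic_cosetpre G N (A B : {group coset_of N}) :
    N <| G -> A <| (G / N)%G -> hypercyclic (G / N)%G A B ->
  hypercyclic G (coset N @*^-1 A)%G (coset N @*^-1 B)%G.
Proof.
move=> nsNG nsAG; elim=> [|{}B L hAB IH sBL nsLG cycLB].
  exact: hypercyclic_refl.
have nsBL := normalS sBL (normal_sub nsLG) (hypercyclic_normal nsAG hAB).
apply: (hypercyclic_step IH); rewrite ?morphpreS //=.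
  by rewrite -(quotientGK nsNG) cosetpre_normal.
have [xN] := cyclic_quotientP nsBL cycLB.
have [x nNx ->] := cosetP xN => Lx sLBx.
apply/cyclic_quotientP; first by rewrite cosetpre_normal.
exists x; first by rewrite mem_morphpre.
rewrite -(quotientSGK (H := N)) ?subsetIl //; last first.
  by apply: subset_trans (joing_subl (coset N @*^-1 B) _); apply: sub_cosetpre.
by rewrite quotientY ?subsetIl ?cycle_subG // !cosetpreK quotient_cycle.
Qed.

(** The first term L of the chain that meets Y does so in a subgroup avoiding
    the previous term B, hence isomorphic to a subgroup of L / B. *)
Lemma hypercyclic_meet G A B Y : A <| G -> Y <| G -> hypercyclic G A B ->
    Y :&: A = 1 -> Y :&: B != 1 ->
  exists Z : {group gT}, [/\ Z <| G, Z \subset Y, cyclic Z & Z :!=: 1].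
Proof.
move=> nsAG nsYG hAB tiYA; elim: hAB => [|{}B L hAB IH sBL nsLG cycLB] ntYL.
  by rewrite tiYA eqxx in ntYL.
have /andP[_ nBG] := hypercyclic_normal nsAG hAB.
have [tiYB|] := eqVneq (Y :&: B) 1; last exact: IH.
exists (Y :&: L)%G; split; rewrite ?normalI ?subsetIl //=.
have nBYL : Y :&: L \subset 'N(B).
  by apply: subset_trans nBG; rewrite subIset // (normal_sub nsYG).
have tiYLB : B :&: (Y :&: L) = 1.
  by rewrite setIA (setIC B) tiYB; apply/setIidPl/sub1G.
rewrite (isog_cyclic (quotient_isog nBYL tiYLB)).
by rewrite (cyclicS _ cycLB) // quotientS // subsetIr.
Qed.

Lemma hypercyclic_meet_prime G A B Y : A <| G -> Y <| G ->
    hypercyclic G A B -> Y :&: A = 1 -> Y :&: B != 1 ->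
  exists Z : {group gT}, [/\ Z <| G, Z \subset Y & prime #|Z|].
Proof.
move=> nsAG nsYG hAB tiYA ntYB.
have [Z [nsZG sZY cycZ ntZ]] := hypercyclic_meet nsAG nsYG hAB tiYA ntYB.
have pr_q := pdiv_prime (etrans (cardG_gt1 Z) ntZ).
have [x Zx ox] := Cauchy pr_q (pdiv_dvd #|Z|).
have sxZ : <[x]> \subset Z by rewrite cycle_subG.
exists <[x]>%G; split; first 2 last.
- by rewrite -[#|_|]/#[x] ox.
- by apply: char_normal_trans nsZG; rewrite sub_cyclic_char.
exact: subset_trans sZY.
Qed.

Lemma hypercyclic_minnormal G A B N : A <| G -> minnormal N G -> N \subset G ->
  hypercyclic G A B -> N :&: A = 1 -> N :&: B != 1 -> cyclic N.
Proof.
move=> nsAG /mingroupP[/andP[ntN nNG] minN] sNG hAB tiNA ntNB.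
have nsNG : N <| G by apply/andP.
have [Z [/andP[_ nZG] sZN cycZ ntZ]] := hypercyclic_meet nsAG nsNG hAB tiNA ntNB.
by rewrite -(minN Z) ?ntZ.
Qed.

Lemma hypercyclic_quotient1 G B N : G \subset 'N(N) ->
  hypercyclic G 1 B -> hypercyclic (G / N)%G 1 (B / N)%G.
Proof.
move=> nNG /(hypercyclic_quotient (normal1 G) nNG).
by rewrite (_ : 1 / N = 1)%G //; apply/val_inj/quotient1.
Qed.

Lemma supersoluble_hypercyclic G : supersoluble G -> hypercyclic G 1 G.
Proof.
case=> s; move: (hypercyclic_refl G 1%G).
move: {2 3 4}1%G; elim: s => [|L s IH] K hK /=.
  by move=> _ defG; rewrite -{2}defG.
case/andP=> /and3P[sKL nsLG cycLK] pLs lastG.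
by apply: IH pLs lastG; apply: hypercyclic_step hK _ _ _.
Qed.

End HypercyclicTransfer.

(** * The hypercenter for supersoluble groups *)

Section UCentral.

Variables (gT : finGroupType) (G K H : {group gT}).
Hypothesis chHK : chief_factor G K H.

(** The action behind the semidirect product is ordinary conjugation, once the
    quotients and restrictions used to define it are unfolded. *)
Lemma chief_gactE u g : u \in H / K -> g \in G ->
  chief_gact chHK u (coset 'C_G(H / K | 'Q) g) = u ^ coset K g.
Proof.
move=> HKu Gg; have := chief_factor_acts chHK; case=> actsG _.
have sHG : H \subset G by case/andP: chHK => _ /normal_sub.
have nKG : G \subset 'N(K).
  by case/andP: chHK => /maxgroupp/andP[].
have nCg : g \in 'N('C_G(H / K | 'Q)).
  rewrite -sub1set (subset_trans _ (normsI (normG G) _)) ?sub1set //.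
  exact: subset_trans actsG (normal_norm (astab_normal _ _)).
have: u \in gact_range (chief_gact chHK) by rewrite chief_gact_range.
case/setIP=> _ fixu; rewrite /chief_gact /=.
rewrite modactE // actbyE // qactJ ifT //; exact: (subsetP nKG).
Qed.

(** Inside the semidirect product H / K is a normal subgroup of a supersoluble
    group, so it contains a nontrivial cyclic normal subgroup; pulled back to G
    this subgroup is invariant under G, and by minimality it is all of H / K. *)
Lemma U_central_cyclic : U_central chHK -> cyclic (H / K).
Proof.
move/supersoluble_hypercyclic; set to := chief_gact chHK => hS.
have defR := chief_gact_range chHK.
have /mingroupP[/andP[ntHK nHKG] minHK] := chief_factor_minnormal chHK.
pose Y := (sdpair1 to @* gact_range to)%G.
have nsY : Y <| [set: sdprod_by to]%G.
  by have /sdprod_context[] := sdprod_sdpair to.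
have [] := hypercyclic_meet (normal1 _) nsY hS.
- by apply/trivgP; rewrite subsetIr.
- rewrite setIT; apply: contra ntHK => /eqP Y1; rewrite /= -defR.
  by rewrite -(morphim_injm_eq1 (injm_sdpair1 to)) // -/Y Y1.
move=> Z [/andP[_ nZ] sZY cycZ ntZ].
have injf := injm_sdpair1 to; pose W := (sdpair1 to @*^-1 Z)%G.
have sWHK : W \subset H / K by rewrite -defR subsetIl.
have fW : sdpair1 to @* W = Z.
  by rewrite morphpreK // (subset_trans sZY).
rewrite -(minHK W) //; first by rewrite -(injm_cyclic injf) ?subsetIl // fW.
rewrite -(morphim_injm_eq1 injf) ?subsetIl // fW ntZ /=.
apply/subsetP=> _ /morphimP[g nKg Gg ->]; rewrite inE.
apply/subsetP=> _ /imsetP[u Wu ->].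
have HKu := subsetP sWHK u Wu; have Ru : u \in gact_range to by rewrite defR.
rewrite -chief_gactE //.
have Dg : coset 'C_G(H / K | 'Q) g \in G / 'C_G(H / K | 'Q).
  exact: mem_quotient.
rewrite inE gact_stable // Ru /= inE sdpair_act // memJ_norm.
  by case/morphpreP: Wu.
by rewrite (subsetP nZ) ?inE.
Qed.

End UCentral.

Section UHypercenter.

Variables (gT : finGroupType) (G : {group gT}).

(** A chief series of G through N is itself the required chain. *)
Lemma chief_factors_hypercyclic (N : {group gT}) : N <| G ->
    (forall K H : {group gT}, chief_factor G K H -> H \subset N -> cyclic (H / K)) ->
  hypercyclic G 1 N.
Proof.
move=> nsNG hN; have [s] := chief_series_exists nsNG.
have: hypercyclic G 1%G 1%G by exact: hypercyclic_refl.
move: {2 3 4}1%G; elim: s => [|L s IH] K hK /=.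
  by move=> _ defN; rewrite -defN.
case/andP=> chLK pLs lastN; apply: IH (pLs) (lastN).
have sLN : L \subset N.
  rewrite -lastN; elim: s L {chLK lastN} pLs => //= M s IHs L /andP[chML /IHs].
  apply: subset_trans.
  by case/andP: chML => /maxgroupp/andP[/proper_sub].
have sKL : K \subset L by case/andP: (chLK) => /maxgroupp/andP[/proper_sub].
apply: hypercyclic_step hK sKL _ _; first by case/andP: chLK.
exact: hN sLN.
Qed.

Lemma U_hypercentral_hypercyclic (N : {group gT}) :
  N <| G -> U_hypercentral G N -> hypercyclic G 1 N.
Proof.
move=> nsNG hN; apply: (chief_factors_hypercyclic nsNG) => K H chHK sHN.
exact: U_central_cyclic (hN K H chHK sHN).
Qed.

Lemma U_hypercenter_hypercyclic : hypercyclic G 1 (U_hypercenter G).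
Proof.
suff []: U_hypercenter G <| G /\ hypercyclic G 1 (U_hypercenter G) by [].
rewrite /U_hypercenter.
elim/big_rec: _ => [|N Z /andP[nsNG /asboolP hN] [nsZG hZ]].
  by split; [apply: normal1 | apply: hypercyclic_refl].
split; first exact: normalY.
apply: hypercyclic_trans (U_hypercentral_hypercyclic nsNG hN) _.
have := hypercyclic_join (normal1 G) nsNG hZ.
rewrite (_ : 1 <*> N = N)%G; last by apply/val_inj; rewrite /= joing1G.
by rewrite (_ : N * Z = Z <*> N)%G //; apply/val_inj; rewrite /= joingC.
Qed.

End UHypercenter.

(** * Residuals and p-nilpotence *)

(** This is O^p(A). Being generated by p'-elements is the form in which it is
    used: it makes O^p monotone and compatible with quotients. *)
Definition p_residual (p : nat) (gT : finGroupType) (A : {set gT}) : {set gT} :=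
  <<[set x in A | p^'.-elt x]>>.

Canonical p_residual_group p (gT : finGroupType) (A : {set gT}) :=
  [group of p_residual p A].

(** The existence of a normal p-complement, which is then the largest normal
    p'-subgroup. *)
Definition p_nilpotent (p : nat) (gT : finGroupType) (X : {set gT}) :=
  p^'.-Hall(X) 'O_p^'(X).

Definition primes_ge (n : nat) : nat_pred := [pred q | (n <= q)%N].
Definition primes_gt (n : nat) : nat_pred := [pred q | (n < q)%N].

Section PResidual.

Variables (p : nat) (gT : finGroupType).
Implicit Types G H K N P X : {group gT}.

Lemma p_residual_sub G : p_residual p G \subset G.
Proof. by rewrite gen_subG; apply/subsetP=> x /setIdP[]. Qed.

Lemma p_residual_normal G : p_residual p G <| G.
Proof.
rewrite /normal p_residual_sub; apply/subsetP=> g Gg; rewrite inE -genJ genS //.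
apply/subsetP=> _ /imsetP[x /setIdP[Gx p'x] ->].
by rewrite inE groupJ // p_eltJ.
Qed.

Lemma p_residual_norm G : 'N(G) \subset 'N(p_residual p G).
Proof.
apply/subsetP=> g nGg; rewrite inE -genJ genS //.
apply/subsetP=> _ /imsetP[x /setIdP[Gx p'x] ->].
by rewrite inE memJ_norm // Gx p_eltJ.
Qed.

Lemma p'_sub_residual G K : K \subset G -> p^'.-group K -> K \subset p_residual p G.
Proof.
move=> sKG p'K; apply/subsetP=> x Kx; apply: mem_gen.
by rewrite inE (subsetP sKG) // (mem_p_elt p'K).
Qed.

Lemma p_residualS H G : H \subset G -> p_residual p H \subset p_residual p G.
Proof.
move=> sHG; apply: genS; apply/subsetP=> x.
by rewrite !inE => /andP[/(subsetP sHG)-> ->].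
Qed.

Lemma p_residual_id G : p_residual p (p_residual p G) = p_residual p G.
Proof.
apply/eqP; rewrite eqEsubset p_residual_sub; apply: genS.
by apply/subsetP=> x Gx; rewrite inE mem_gen //; case/setIdP: Gx.
Qed.

Lemma p_residual_min G N : N <| G -> p.-group (G / N) -> p_residual p G \subset N.
Proof.
case/andP=> _ nNG pGN; rewrite gen_subG; apply/subsetP=> x /setIdP[Gx p'x].
have nNx := subsetP nNG x Gx; apply: coset_idr => //.
have p'xN : p^'.-elt (coset N x) by exact: morph_p_elt.
have pxN : p.-elt (coset N x) by apply: mem_p_elt pGN _; apply: mem_quotient.
by apply/eqP; rewrite -order_eq1 -dvdn1 -(eqnP (pnat_coprime pxN p'xN)) gcdnn.
Qed.

Lemma p_residual_quotient G : prime p -> p.-group (G / p_residual p G).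
Proof.
move=> pr_p; apply/pgroupP=> q pr_q /Cauchy[] // xN.
have /andP[_ nRG] := p_residual_normal G.
case/morphimP=> x nRx Gx -> ox; apply/idPn=> p'q.
have : coset (p_residual p G) x.`_p^' = 1.
  by apply: coset_id; apply: mem_gen; rewrite inE p_elt_constt groupX.
rewrite morph_constt // constt_p_elt; first by move/eqP; rewrite -order_eq1 ox;
  case: q pr_q {ox p'q} => [|[]].
by rewrite /p_elt ox pnatE.
Qed.

Lemma p_residual_Sylow G P : prime p -> p.-Sylow(G) P -> p_residual p G * P = G.
Proof.
move=> pr_p sylP; have [sPG _ _] := and3P sylP.
have [sRG nRG] := andP (p_residual_normal G).
apply/eqP; rewrite eqEsubset mul_subG //= -quotientSK //.
have := quotient_pHall (subset_trans sPG nRG) sylP.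
by move/pHall_id=> -> //; apply: p_residual_quotient.
Qed.

End PResidual.

Section Cyclic.

Variable gT : finGroupType.
Implicit Types A B G H K N P X : {group gT}.

(** The quotient of B by the centraliser embeds in Aut(A), whose order is the
    totient of |A|. *)
Lemma cyclic_index_cent A B : cyclic A -> B \subset 'N(A) ->
  #|B : 'C_B(A)| %| totient #|A|.
Proof.
move=> cycA nAB; rewrite -card_Aut_cyclic // indexgI.
have := card_morphim (conj_aut A) B.
rewrite ker_conj_aut (setIidPr nAB) => <-.
by rewrite cardSg // Aut_conj_aut.
Qed.

Lemma pgroup_index_eq1 (pi : nat_pred) A B :
  A \subset B -> pi.-group B -> pi^'.-nat #|B : A| -> A :=: B.
Proof.
move=> sAB piB pi'i; apply/eqP; rewrite eqEsubset sAB -indexg_eq1 /=.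
have pii : pi.-nat #|B : A| by apply: pnat_dvd piB; apply: dvdn_indexg.
by rewrite -dvdn1 -(eqnP (pnat_coprime pii pi'i)) gcdnn.
Qed.

(** If |A| = r is prime, Aut(A) has order r - 1, which is too small for the primes
    dividing |B|. *)
Lemma primes_ge_cent_prime A B :
  prime #|A| -> B \subset 'N(A) -> (primes_ge #|A|).-group B -> B \subset 'C(A).
Proof.
move=> prA nAB geB; apply/setIidPl; apply: (pgroup_index_eq1 _ geB).
  exact: subsetIl.
have := cyclic_index_cent (prime_cyclic prA) nAB; rewrite totient_prime // => dvdi.
apply/pnatP=> // q pr_q qi; rewrite !inE -ltnNge.
have q_dvd := dvdn_trans qi dvdi.
rewrite -(prednK (prime_gt0 prA)) ltnS; apply: dvdn_leq q_dvd.
by rewrite -ltnS prednK ?prime_gt0 ?prime_gt1.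
Qed.

End Cyclic.

(** * Transfer into a cyclic Sylow subgroup *)

Section PNilpotent.

Variables (p : nat) (gT : finGroupType).
Implicit Types G H K N P X : {group gT}.

Lemma normal_Hall_p_nilpotent X K : K <| X -> p^'.-Hall(X) K -> p_nilpotent p X.
Proof. by move=> nsKX hallK; rewrite /p_nilpotent (normal_Hall_pcore hallK). Qed.

Lemma p_nilpotentE X : prime p -> p_nilpotent p X = p^'.-group (p_residual p X).
Proof.
move=> pr_p; have nsR := p_residual_normal p X; apply/idP/idP => [nilX | p'R].
  apply: pgroupS (pcore_pgroup p^' X); apply: p_residual_min (pcore_normal _ _) _.
  rewrite /pgroup card_quotient ?gFnorm //.
  by case/and3P: nilX => _ _; rewrite pnatNK.
apply: (normal_Hall_p_nilpotent nsR); rewrite /pHall p_residual_sub p'R.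
rewrite -card_quotient ?normal_norm // pnatNK.
exact: p_residual_quotient.
Qed.

End PNilpotent.

Section CyclicSylow.

Variables (p : nat) (gT : finGroupType) (X P : {group gT}).
Hypotheses (pr_p : prime p) (geX : (primes_ge p).-group X).
Hypotheses (sylP : p.-Sylow(X) P) (cycP : cyclic P).

Let sPX : P \subset X. Proof. exact: pHall_sub sylP. Qed.
Let pP : p.-group P. Proof. exact: pHall_pgroup sylP. Qed.

(** The index of the centraliser of z in its normaliser is prime to p, because P
    is abelian, and divides the order of the automorphism group of a cyclic
    p-group; only primes smaller than p are left, and these do not divide |X|. *)
Lemma norm_cycle_Sylow_cent z t : z \in P -> t \in X -> t \in 'N(<[z]>) -> t \in 'C[z].
Proof.
move=> Pz Xt nzt; rewrite -cent_cycle; set A := <[z]>%G.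
have pA : p.-group A by apply: pgroupS pP; rewrite cycle_subG.
suff /setIidPl/subsetP : 'N_X(A) :&: 'C(A) = 'N_X(A).
  by apply; rewrite inE Xt.
have sPC : P \subset 'C(A).
  by rewrite centsC cycle_subG (subsetP (cyclic_abelian cycP)).
have sPN : P \subset 'N_X(A) by rewrite subsetI sPX (subset_trans sPC) ?cent_sub.
apply: (pgroup_index_eq1 _ (pgroupS (subsetIl X _) geX)); first exact: subsetIl.
have p'i : p^'.-nat #|'N_X(A) : 'N_X(A) :&: 'C(A)|.
  apply: pnat_dvd (_ : p^'.-nat #|X : P|); last by case/and3P: sylP.
  apply: dvdn_trans (_ : #|'N_X(A) : P| %| _); last exact: indexSg (subsetIl _ _).
  by apply: indexgS; rewrite subsetI sPN.
have := cyclic_index_cent (cycle_cyclic z) (subsetIr X 'N(<[z]>)).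
rewrite -/A (card_pgroup pA) => dvdi; apply/pnatP=> // q pr_q qi.
have p'q : q != p by have := pnatP _ _ p'i q pr_q qi; rewrite ?inE; apply.
rewrite !inE -ltnNge; have := dvdn_trans qi dvdi.
case: (logn p _) => [|n]; first by rewrite expn0 Euclid_dvd1.
rewrite totient_pfactor // Euclid_dvdM // Euclid_dvdX // (dvdn_prime2 pr_q pr_p).
rewrite (negPf p'q) /= orbF => /dvdn_leq q_le.
by rewrite -(prednK (prime_gt0 pr_p)) ltnS q_le // -ltnS prednK ?prime_gt0 ?prime_gt1.
Qed.

Import FiniteModule.
Open Scope ring_scope.

(** The factors of the transfer of x are conjugates x^n ^ t^-1 that lie in P.
    Subgroups of the cyclic group P are determined by their order, so t
    normalises, hence centralises, the group generated by x^n. *)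
Lemma transfer_cyclic_Sylow (abP : abelian (idm P @* P)) x : x \in P ->
  transfer X abP x = fmod abP (x ^+ #|X : P|)%g.
Proof.
move=> Px; have Xx := subsetP sPX x Px.
have partX := rcosets_cycle_partition sPX Xx.
have trT := transversalP partX; set T := transversal _ _ in trT.
have sTX := transversal_sub trT.
rewrite (transfer_cycle_expansion sPX _ Xx trT).
rewrite -(sum_index_rcosets_cycle sPX Xx trT) fmodX; last first.
  by rewrite /= im_idm.
rewrite [RHS](big_morph _ (GRing.mulrnDr _) (GRing.mulr0n _)).
apply: eq_bigr => t Tt; rewrite -fmodX /=; last by rewrite im_idm.
set n := #|_ : _|; congr (fmod _ _).
have Xt := subsetP sTX t Tt.
have Pxn : (x ^+ n)%g \in P by rewrite groupX.
have Pxnt : (x ^+ n ^ t^-1)%g \in P.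
  have := mulg_exp_card_rcosets P x t.
  by rewrite mem_rcoset /conjg invgK mulgA.
suff : (t^-1)%g \in 'C[x ^+ n]%g.
  by move/cent1P/commute_sym/commgP/conjg_fixP.
apply: norm_cycle_Sylow_cent; rewrite ?groupV //.
rewrite -groupV; apply/normP/eqP; rewrite -cycleJ (eq_subG_cyclic cycP) ?cycle_subG //.
by rewrite -!orderE orderJ.
Qed.

(** The index of P is prime to p, so the transfer is injective on P and its
    kernel is a normal p-complement. *)
Lemma cyclic_Sylow_p_nilpotent : p_nilpotent p X.
Proof.
have abP : abelian (idm P @* P) by rewrite im_idm cyclic_abelian.
pose f := @transfer_morphism _ _ X P _ abP.
have inj_fP x : x \in P -> f x = 1%g -> x = 1%g.
  move=> Px; rewrite /f /= transfer_cyclic_Sylow // => /(congr1 (@fmval _ _ _)).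
  rewrite fmodK /=; last by rewrite im_idm groupX.
  move=> xn1; have [_ _ p'i] := and3P sylP.
  by rewrite -(expgK (pnat_coprime pP p'i) Px) xn1 expg1n.
have nsK : 'ker f <| X by apply: ker_normal.
rewrite p_nilpotentE //; apply: pgroupS (_ : p^'.-group ('ker f)).
  apply: p_residual_min => //; rewrite (isog_pgroup _ (first_isog f)).
  have pT : p.-group [set: fmod_of abP].
    have -> : [set: fmod_of abP] = fmod abP @* (idm P @* P).
      apply/setP=> u; rewrite inE; apply/esym/imsetP; exists (fmval u).
        by rewrite setIid; apply: fmodP.
      exact: esym (fmvalK (u : fmod_of abP)).
    by rewrite morphim_pgroup // morphim_pgroup.
  exact: pgroupS (subsetT _) pT.
rewrite -partG_eq1 -(card_Hall (Sylow_setI_normal nsK sylP)).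
rewrite -trivg_card1; apply/eqP/trivgP; apply/subsetP=> x.
by case/setIP=> /mker fx1 Px; rewrite inE (inj_fP x Px fx1).
Qed.

End CyclicSylow.

(** * Tate's theorem *)

Section Tate.

Variables (p : nat) (gT : finGroupType).
Implicit Types G N P Q R : {group gT}.

Section Splitting.

Variables R P Q1 : {group gT}.
Hypotheses (pr_p : prime p) (pP : p.-group P) (nRP : P \subset 'N(R)).
Hypotheses (sylQ : p.-Sylow(R) (R :&: P)) (genR : p_residual p R = R).
Hypotheses (nsQ1 : Q1 <| P) (sQ1 : Q1 \subset R :&: P).
Hypothesis abQ : abelian ((R :&: P) / Q1).

Let nQ1P : P \subset 'N(Q1). Proof. exact: normal_norm. Qed.
Let Qb := ((R :&: P) / Q1)%G.
Let Pb := (P / Q1)%G.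

Let d (x : gT) := (x, coset Q1 x).
Let dM : {in P &, {morph d : x y / x * y}}.
Proof. by move=> x y Px Py; congr (_, _); rewrite morphM ?(subsetP nQ1P). Qed.
Let dm := Morphism dM.
Let E := (dm @* P)%G.
Let A := setX_group (1%G : {group gT}) Qb.
Let N1 := setX_group R (1%G : {group coset_of Q1}).

Let Edef u : u \in E -> exists2 x, x \in P & u = (x, coset Q1 x).
Proof. by case/morphimP=> x _ Px ->; exists x. Qed.

Let Ex x : x \in P -> (x, coset Q1 x) \in E.
Proof. by move=> Px; apply: (mem_morphim dm). Qed.

Let Adef u : u \in A -> exists2 q, q \in Qb & u = (1, q).
Proof. by case: u => a q /setXP[/set1P-> Qq]; exists q. Qed.

Let Ax q : q \in Qb -> (1, q) \in A.
Proof. by move=> Qq; apply/setXP; rewrite set11. Qed.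

Let N1def u : u \in N1 -> exists2 r, r \in R & u = (r, 1).
Proof. by case: u => a q /setXP[Ra /set1P->]; exists a. Qed.

Let N1x r : r \in R -> (r, 1) \in N1.
Proof. by move=> Rr; apply/setXP; rewrite set11. Qed.

Let nN1E : E \subset 'N(N1).
Proof.
apply/subsetP=> _ /Edef[x Px ->]; rewrite inE;
  apply/subsetP=> _ /imsetP[u /N1def[r Rr ->] ->].
suff -> : (r, 1) ^ (x, coset Q1 x) = (r ^ x, 1).
  by apply: N1x; rewrite memJ_norm ?(subsetP nRP).
by congr (_, _); rewrite /= -conjgE conj1g.
Qed.

Let nAE : E \subset 'N(A).
Proof.
apply/subsetP=> _ /Edef[x Px ->]; rewrite inE;
  apply/subsetP=> _ /imsetP[u /Adef[q Qq ->] ->].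
suff -> : (1, q) ^ (x, coset Q1 x) = (1, q ^ coset Q1 x).
  apply: Ax; rewrite memJ_norm //; apply: (subsetP (_ : Pb \subset _));
    last exact: mem_quotient.
  by apply: quotient_norms; rewrite normsI ?normG.
by congr (_, _); rewrite /= -conjgE conj1g.
Qed.

Let cAN1 : N1 \subset 'C(A).
Proof.
apply/subsetP=> _ /N1def[r Rr ->]; apply/centP=> _ /Adef[q Qq ->].
by congr (_, _); rewrite /= ?mulg1 ?mul1g.
Qed.

Let Gh := (N1 <*> E)%G.
Let Ph := (A <*> E)%G.
Let GhE : Gh :=: N1 * E. Proof. by rewrite /= norm_joinEr. Qed.
Let PhE : Ph :=: A * E. Proof. by rewrite /= norm_joinEr. Qed.

Let sQP q : q \in R :&: P -> (1, coset Q1 q) \in Gh /\ (q, 1) \in Ph.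
Proof.
move=> Qq; have [Rq Pq] := setIP Qq; split.
  have -> : (1, coset Q1 q) = (q^-1, 1) * (q, coset Q1 q).
    by congr (_, _); rewrite /= ?mulVg ?mul1g.
  by rewrite GhE mem_mulg ?N1x ?groupV ?Ex.
have -> : (q, 1) = (1, (coset Q1 q)^-1) * (q, coset Q1 q).
  by congr (_, _); rewrite /= ?mulVg ?mul1g.
by rewrite PhE mem_mulg ?Ex // Ax // groupV mem_quotient.
Qed.

Let sAG : A \subset Gh.
Proof. by apply/subsetP=> _ /Adef[_ /morphimP[q _ Qq ->] ->]; have [] := sQP Qq. Qed.

Let nsAG : A <| Gh.
Proof.
rewrite /normal sAG join_subG nAE andbT.
by apply: subset_trans cAN1 (cent_sub _).
Qed.

(** Inside the direct product of the ambient group with P / Q1, let E be the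
    copy of P made of the pairs (x, x Q1), and N1 the copy of R in the first
    factor. The group N1 E contains the second copy A of (R :&: P) / Q1 as an
    abelian normal p-subgroup, and E is a complement of A in A E, a subgroup of
    index prime to p; the theorem of Gaschuetz extends the splitting. *)
Lemma diagonal_extension_split : [splits Gh, over A].
Proof.
have sPG : Ph \subset Gh by rewrite join_subG sAG joing_subr.
rewrite (Gaschutz_split nsAG (joing_subl _ _) sPG).
- apply/splitsP; exists E; apply/complP; split; last by rewrite -PhE.
  apply/trivgP/subsetP=> _ /setIP[/Adef[q _ ->] /Edef[x _ [<- ->]]].
  by rewrite morph1 inE.
- rewrite /abelian; apply/subsetP=> _ /Adef[q Qq ->]; apply/centP=> _ /Adef[q' Qq' ->].
  by congr (_, _); apply: (centsP abQ).
have pA : p.-group A.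
  rewrite /pgroup cardsX cards1 mul1n; apply: quotient_pgroup.
  exact: pgroupS (subsetIr _ _) pP.
apply: pnat_coprime pA _.
(* Gh = N1 Ph, so the index of Ph divides that of R :&: P in R. *)
have -> : #|Gh : Ph| = #|N1 : Ph|.
  have GhP : Gh :=: N1 * Ph.
    apply/eqP; rewrite eqEsubset GhE mulgS ?joing_subr //= -GhE mul_subG ?joing_subl //.
  apply/eqP; rewrite -(eqn_pmul2l (cardG_gt0 Ph)) Lagrange // GhP.
  by rewrite -card_invg invMg !invGid LagrangeMl.
apply: pnat_dvd (_ : p^'.-nat #|R : R :&: P|); last by case/and3P: sylQ.
pose Q2 := setX_group (R :&: P)%G (1%G : {group coset_of Q1}).
have sQ2N : Q2 \subset N1 by rewrite setXS ?subsetIl.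
have -> : #|R : R :&: P| = #|N1 : Q2|.
  by rewrite -!divgS ?subsetIl // !cardsX cards1 !muln1.
apply: indexgS; apply/subsetP=> -[q b] /setXP[Qq /set1P->].
by have [] := sQP Qq.
Qed.

(** A complement C of A contains every p'-element of N1, since N1 centralises the
    p-group A, and therefore all of N1 because R is generated by its
    p'-elements. The projection of C to P / Q1 then complements (R :&: P) / Q1;
    but a subgroup of the Frattini subgroup has no complement unless trivial. *)
Lemma Sylow_sub_of_sub_Phi : (R :&: P) / Q1 \subset 'Phi(P / Q1) -> R :&: P \subset Q1.
Proof.
have /splitsP[C /complP[tiAC defAC]] := diagonal_extension_split.
have sCG : C \subset Gh by rewrite -defAC mulG_subr.
have sN1C : N1 \subset C.
  suff sRC : R \subset @pairg1 gT (coset_of Q1) @*^-1 C.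
    by apply/subsetP=> _ /N1def[r /(subsetP sRC)/morphpreP[_ Cr] ->].
  rewrite -genR gen_subG; apply/subsetP=> r /setIdP[Rr p'r]; rewrite !inE /=.
  have : (r, 1) \in A * C by rewrite defAC GhE -[(r, 1)]mulg1 mem_mulg ?N1x.
  case/mulsgP=> a c Aa Cc def_r.
  have def_c : c = a^-1 * (r, 1) by rewrite def_r mulKg.
  have cac : commute a^-1 (r, 1).
    by apply: commute_sym; apply: (centsP cAN1); rewrite ?N1x ?groupV.
  suff def_c' : c.`_p^' = (r, 1).
    by change ((r, 1) \in C); rewrite -def_c' groupX.
  have pa : p.-elt a^-1.
    rewrite p_eltV; have [q /morphimP[x _ /setIP[_ Px] ->] ->] := Adef Aa.
    have -> : (1, coset Q1 x) = @pair1g gT (coset_of Q1) (coset Q1 x) by [].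
    apply: morph_p_elt; rewrite ?inE //; apply: morph_p_elt.
      exact: (subsetP nQ1P).
    exact: mem_p_elt pP _.
  (* The p'-part of c = a^-1 (r, 1) is (r, 1), since a is a p-element. *)
  rewrite def_c consttM //; have /constt1P-> : p^'^'.-elt a^-1 by rewrite p_eltNK.
  rewrite mul1g constt_p_elt //.
  have -> : (r, 1) = @pairg1 gT (coset_of Q1) r by [].
  by apply: morph_p_elt; rewrite ?inE.
move=> sQPhi.
pose Cb := (@snd gT (coset_of Q1) @* C)%G.
have sPQC : Pb \subset Qb * Cb.
  apply/subsetP=> _ /morphimP[x _ Px ->].
  have : (x, coset Q1 x) \in A * C by rewrite defAC (subsetP (joing_subr _ _)) ?Ex.
  case/mulsgP=> _ c /Adef[q Qq ->] Cc def_x.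
  rewrite /=; have -> : coset Q1 x = q * c.2 by apply: (congr1 snd def_x).
  by rewrite mem_mulg //; apply: mem_morphim; rewrite ?inE.
have tiQC : Qb :&: Cb = 1.
  apply/trivgP/subsetP=> b /setIP[Qb' /morphimP[c _ Cc def_b]].
  have Ga : (1, b) \in Gh by rewrite (subsetP sAG) ?Ax.
  have : c * (1, b)^-1 \in Gh by rewrite groupM ?groupV // (subsetP sCG).
  have -> : c * (1, b)^-1 = (c.1, 1).
    by case: c Cc def_b => [c1 c2] _ /= ->; congr (_, _);
      rewrite /= ?invg1 ?mulg1 ?mulgV.
  rewrite GhE; case/mulsgP=> _ _ /N1def[r Rr ->] /Edef[x Px ->] def_u.
  have def_c1 : c.1 = r * x := congr1 fst def_u.
  have : 1 = 1 * coset Q1 x := congr1 snd def_u.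
  rewrite mul1g => /esym/(coset_idr (subsetP nQ1P x Px)) Q1x.
  have Nc : (c.1, 1) \in C.
    apply: (subsetP sN1C); apply: N1x; rewrite def_c1 groupM //.
    by case/setIP: (subsetP sQ1 x Q1x).
  have : (1, b) \in A :&: C.
    rewrite inE Ax //=; have -> : (1, b) = (c.1, 1)^-1 * c.
      by rewrite def_b; case: (c) => c1 c2; congr (_, _);
        rewrite /= ?mulVg ?invg1 ?mul1g.
    by rewrite groupM ?groupV.
  by rewrite tiAC => /set1P[->]; rewrite inE.
have sCP : Cb \subset Pb.
  apply/subsetP=> _ /morphimP[c _ Cc ->].
  have := subsetP sCG c Cc; rewrite GhE.
  case/mulsgP=> _ _ /N1def[r Rr ->] /Edef[x Px ->] ->.
  by rewrite /= mul1g mem_quotient.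
have defC : Cb :=: Pb.
  rewrite -(genGid Cb); apply: Phi_nongen; apply/eqP.
  rewrite eqEsubset join_subG Phi_sub sCP /=.
  apply: subset_trans sPQC _; rewrite mul_subG ?joing_subr //.
  exact: subset_trans sQPhi (joing_subl _ _).
rewrite -quotient_sub1; last by rewrite subIset // nQ1P orbT.
by rewrite -tiQC defC subsetI subxx quotientS ?subsetIr.
Qed.

End Splitting.

(** With R = O^p(N) and Q = R :&: P, the preceding lemma applied to Q1 = Phi(Q)
    gives Q <= Phi(Q), hence Q = 1. *)
Theorem Tate G P N : prime p -> p.-Sylow(G) P -> N <| G ->
  N :&: P \subset 'Phi(P) -> p_nilpotent p N.
Proof.
move=> pr_p sylP /andP[sNG nNG] sNPhi.
have pP := pHall_pgroup sylP; have sPG := pHall_sub sylP.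
pose R := [group of p_residual p N].
have sRN : R \subset N := p_residual_sub p N.
have nRG : G \subset 'N(R) by apply: subset_trans nNG (p_residual_norm p N).
have nsRG : R <| G by rewrite /normal (subset_trans sRN).
have sylQ := Sylow_setI_normal nsRG sylP.
rewrite p_nilpotentE // -partG_eq1 -(card_Hall sylQ) -trivg_card1.
set Q := (R :&: P)%G; have pQ : p.-group Q := pgroupS (subsetIr _ _) pP.
have nsQP : Q <| P by rewrite /normal subsetIr normsI ?normG ?(subset_trans sPG).
have nsQ1P : 'Phi(Q) <| P := gFnormal_trans _ nsQP.
apply: contraT => ntQ; have := Phi_proper ntQ; rewrite properE => /andP[sPhiQ].
apply: contraNT => _; apply: (@Sylow_sub_of_sub_Phi R P 'Phi(Q)%G) => //.
- exact: subset_trans nRG.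
- exact: p_residual_id.
- exact: abelem_abelian (Phi_quotient_abelem pQ).
rewrite -(quotient_Phi pP (normal_norm nsQ1P)) quotientS //.
by apply: subset_trans sNPhi; rewrite setSI.
Qed.

End Tate.

(** * Hall subgroups with a Sylow tower *)

(** For every bound n the elements whose order involves only primes above n
    form a normal Hall subgroup: the tower starts with the largest primes. *)
Definition Sylow_tower (gT : finGroupType) (K : {set gT}) : Prop :=
  forall n, (primes_gt n).-Hall(K) 'O_(primes_gt n)(K).

Lemma normal_Hall_pcore_Hall (pi : nat_pred) (gT : finGroupType) (G H : {group gT}) :
  pi.-Hall(G) H -> H <| G -> pi.-Hall(G) 'O_pi(G).
Proof. by move=> hallH nsHG; rewrite (normal_Hall_pcore hallH). Qed.

(** Induction on |Y|: let A be a normal subgroup of prime order r and B / A the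
    normal Hall subgroup of Y / A for the primes above n. If r > n then B
    itself is the Hall subgroup wanted; otherwise B centralises A, because its
    primes are at least r, so B splits as a direct product over A. *)
Lemma hypercyclic_Sylow_tower (gT : finGroupType) (Y : {group gT}) :
  hypercyclic Y 1 Y -> Sylow_tower Y.
Proof.
move=> hY n; have [m leYm] := ubnP #|Y|.
elim: m => // m IH in gT Y hY leYm *; set pi := primes_gt n.
have [Y1 | ntY] := eqVneq (Y :&: Y) 1.
  rewrite setIid in Y1; rewrite Y1 pcore_pgroup_id ?pgroup1 //.
  by rewrite /pHall subxx pgroup1 indexgg.
have [|A [nsAY sAY prA]] := hypercyclic_meet_prime (normal1 Y) (normal_refl Y) hY _ ntY.
  by apply/setIidPr/sub1G.
have ntA : A :!=: 1 by rewrite -cardG_gt1 prime_gt1.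
have hYA := hypercyclic_quotient1 (normal_norm nsAY) hY.
have /IH : #|Y / A| < m by apply: leq_trans (ltn_quotient ntA sAY) _.
move/(_ hYA); rewrite -/pi => hallB.
have [B defB sAB nsBY] := inv_quotientN nsAY (pcore_normal pi _).
have nsAB : A <| B := normalS sAB (normal_sub nsBY) nsAY.
rewrite /= defB in hallB; have piBA : pi.-group (B / A) := pHall_pgroup hallB.
have pi'YB : pi^'.-nat #|Y : B|.
  case/and3P: hallB => _ _.
  rewrite /= index_quotient_eq ?normal_norm ?normal_sub //.
  by rewrite (setIidPr sAY).
(* pi consists of the primes above n, and A has prime order. *)
have [piA | pi'A] := boolP (pi.-group A).
  apply: normal_Hall_pcore_Hall (nsBY); rewrite /pHall (normal_sub nsBY) pi'YB andbT.
  by rewrite -(pquotient_pgroup piA) ?normal_norm.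
have ltAn : #|A| <= n.
  by rewrite leqNgt; apply: contra pi'A => ?; rewrite /pgroup pnatE ?inE.
have {}pi'A : pi^'.-group A by rewrite /pgroup pnatE // !inE -leqNgt.
(* All primes dividing |B| are at least |A|, the ones above n included. *)
have cAB : B \subset 'C(A).
  apply: primes_ge_cent_prime; rewrite ?normal_norm //.
  rewrite /pgroup -(Lagrange sAB) -card_quotient ?normal_norm // pnatM.
  rewrite pnatE // inE leqnn /=; apply: sub_pgroup piBA => q.
  by rewrite !inE => /ltnW; apply: leq_trans.
have hallA : pi^'.-Hall(B) A.
  by rewrite /pHall sAB pi'A -card_quotient ?normal_norm // pnatNK.
have [J /complP[tiAJ defJ]] := splitsP (SchurZassenhaus_split (pHall_Hall hallA) nsAB).
have dB : A \x J = B.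
  by rewrite dprodE // (subset_trans _ cAB) // -defJ mulG_subr.
have [_ nsJB] := dprod_normal2 dB.
have hallJ : pi.-Hall(B) J.
  rewrite /pHall (normal_sub nsJB) -divgS ?normal_sub // -(dprod_card dB) mulnK //.
  rewrite /= [X in _ && X]pi'A andbT; have := piBA;
    rewrite /pgroup card_quotient ?normal_norm //.
  by rewrite -divgS // -(dprod_card dB) mulKn.
have nsJY : J <| Y.
  by rewrite -(normal_Hall_pcore hallJ nsJB) gFnormal_trans.
apply: normal_Hall_pcore_Hall (nsJY); have [sJB piJ pi'BJ] := and3P hallJ.
by rewrite /pHall (normal_sub nsJY) piJ -(Lagrange_index (normal_sub nsBY) sJB)
  pnatM pi'YB.
Qed.

Section SylowTower.

Variable gT : finGroupType.
Implicit Types K X : {group gT}.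

Lemma Sylow_towerJ K x : Sylow_tower K -> Sylow_tower (K :^ x).
Proof. by move=> towK n; rewrite pcoreJ pHallJ2. Qed.

Lemma Sylow_tower_quotient K (Q : {group gT}) : K \subset 'N(Q) -> Sylow_tower
  K -> Sylow_tower (K / Q).
Proof.
move=> nQK towK n; have hallQ := quotient_pHall (subset_trans (pcore_sub _ _)
  nQK) (towK n).
by apply: (normal_Hall_pcore_Hall hallQ); rewrite quotient_normal ?pcore_normal.
Qed.

(** For n one less than the largest prime divisor q, the only prime of |K| above
    n is q. *)
Lemma Sylow_tower_max_pdiv K (q := max_pdiv #|K|) :
  Sylow_tower K -> q.-Sylow(K) 'O_(primes_gt q.-1)(K).
Proof.
move/(_ q.-1); apply: etrans; apply: eq_in_pHall => r.
rewrite mem_primes => /and3P[pr_r _ rK]; rewrite !inE.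
have r_le : r <= q by apply: max_pdiv_max; rewrite // mem_primes pr_r cardG_gt0.
have q_gt0 : 0 < q by apply: leq_trans (prime_gt0 pr_r) r_le.
by rewrite prednK // eqn_leq r_le.
Qed.

End SylowTower.

(** Hall subgroups need not be conjugate in general. Here the Sylow subgroups
    of K1 and K2 for their largest prime q are Sylow in X; once they are made
    equal to Q by a conjugation, Q is normal in both Hall subgroups, and
    induction applies in N_X(Q) / Q. *)
Theorem Sylow_tower_Hall_trans (pi : nat_pred) (gT : finGroupType) (X K1 K2 :
  {group gT}) :
    pi.-Hall(X) K1 -> pi.-Hall(X) K2 -> Sylow_tower K1 -> Sylow_tower K2 ->
  exists2 x, x \in X & K2 :=: K1 :^ x.
Proof.
have [m] := ubnP #|X|.
elim: m => // m IH in gT X K1 K2 * => leXm hall1 hall2 tow1 tow2.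
have eqK12 : #|K1| = #|K2| by rewrite (card_Hall hall1) (card_Hall hall2).
have [K1_1 | ntK1] := eqVneq (K1 : {set gT}) 1.
  exists 1; rewrite ?group1 // conjsg1 K1_1; apply/eqP.
  by rewrite trivg_card1 -eqK12 K1_1 cards1.
have := Sylow_tower_max_pdiv tow1; have := Sylow_tower_max_pdiv tow2.
rewrite -eqK12; set q := max_pdiv _; set Q2 := 'O_(_)(K2); set Q1 := 'O_(_)(K1).
have pr_q : prime q by rewrite max_pdiv_prime // cardG_gt1.
have pi_q : q \in pi.
  by apply: (pnatP _ _ (pHall_pgroup hall1)); rewrite ?max_pdiv_dvd.
move=> syl2 syl1.
have := subHall_Sylow hall2 pi_q syl2; have := subHall_Sylow hall1 pi_q syl1.
move=> sylX1 sylX2; have [x Xx] := Sylow_trans sylX1 sylX2.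
rewrite /= => eqQ; have defQ2 : Q2 = Q1 :^ x := eqQ.
pose K3 := (K1 :^ x)%G.
have hall3 : pi.-Hall(X) K3 by rewrite pHallJ.
have tow3 : Sylow_tower K3 by exact: Sylow_towerJ.
have nsQ2 : Q2 <| K2 := pcore_normal _ _.
have nsQ3 : Q2 <| K3 by rewrite defQ2 normalJ pcore_normal.
pose Q := [group of Q2]; pose N := 'N_X(Q)%G.
have sQX : Q \subset X := pHall_sub sylX2.
have sub_N (K : {group gT}) : pi.-Hall(X) K -> Q <| K -> pi.-Hall(N) K.
  case/and3P=> sKX piK hallK /andP[sQK nQK].
  have sKN : K \subset N by rewrite subsetI sKX.
  apply: (pHall_subl sKN (subsetIl X _)).
  by rewrite /pHall sKX piK.
have ntQ : Q :!=: 1.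
  rewrite trivg_card1 (card_Hall syl2) p_part_eq1 mem_primes pr_q cardG_gt0 /=.
  by rewrite -eqK12 negbK max_pdiv_dvd.
have [|||||y] := IH _ (N / Q)%G (K3 / Q)%G (K2 / Q)%G.
- apply: leq_trans (_ : #|N| <= m).
    by rewrite ltn_quotient // subsetI sQX normG.
  by apply: leq_trans (subset_leq_card (subsetIl _ _)) _.
- by rewrite quotient_pHall ?normal_norm // sub_N.
- by rewrite quotient_pHall ?normal_norm // sub_N.
- by apply: Sylow_tower_quotient; rewrite ?normal_norm.
- by apply: Sylow_tower_quotient; rewrite ?normal_norm.
case/morphimP=> z nQz /setIP[Xz _] ->; rewrite -quotientJ // => defK2.
exists (x * z); first by rewrite groupM.
rewrite conjsgM; apply: quotient_inj defK2 => //.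
by rewrite -(normP nQz) normalJ.
Qed.

(** If no prime of |Y| is below p, the primes above p are the primes other than
    p. *)
Lemma Sylow_tower_p_nilpotent p (gT : finGroupType) (Y : {group gT}) :
  (primes_ge p).-group Y -> Sylow_tower Y -> p_nilpotent p Y.
Proof.
move=> geY /(_ p) hallY; apply: (@normal_Hall_p_nilpotent _ _ _ _ (pcore_normal
  (primes_gt p) Y)).
rewrite -(eq_in_pHall (pi := primes_gt p)) // => q piYq.
rewrite !inE ltn_neqAle eq_sym -[RHS]andbT; congr (_ && _).
apply: (pnatP _ _ geY) => //; first by move: piYq; rewrite mem_primes => /and3P[].
by move: piYq; rewrite mem_primes => /and3P[].
Qed.

(** * s-permutable p-subgroups *)

Section SPermutable.

Variables (p : nat) (gT : finGroupType).
Implicit Types A G M N P Q T X : {group gT}.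

(** Permuting with every Sylow p-subgroup, A lies in all of them, so in O_p(G).
    For a Sylow q-subgroup Q with q different from p, A is then the intersection
    of the group A Q with O_p(G), so Q normalises it. *)
Lemma s_permutable_pgroup_norm G A : prime p -> A \subset G -> p.-group A ->
  s_permutable G A -> p_residual p G \subset 'N(A).
Proof.
move=> pr_p sAG pA permA.
have sAO : A \subset 'O_p(G).
  apply/bigcapsP=> S; rewrite max_pgroup_Sylow => sylS.
  have defAS : A <*> S = A * S by apply: comm_joingE; apply: permA sylS.
  have pS := pHall_pgroup sylS.
  rewrite -(sub_pHall sylS (K := (A <*> S)%G)) ?joing_subl ?joing_subr //.
    by rewrite /= defAS pgroupM pA.
  by rewrite join_subG sAG (pHall_sub sylS).
rewrite gen_subG; apply/subsetP=> x /setIdP[Gx p'x].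
rewrite -cycle_subG -(Sylow_gen <[x]>) gen_subG;
  apply/bigcupsP=> R /SylowP[q pr_q sylR].
have [sRx qR _] := and3P sylR.
have [eq_qp | p'q] := eqVneq q p.
  suff -> : R :=: 1 by apply: sub1G.
  apply/eqP; rewrite trivg_card1 -dvdn1.
  have p'R : p^'.-group R := pgroupS sRx p'x.
  by rewrite eq_qp in qR; rewrite -(eqnP (pnat_coprime qR p'R)) gcdnn.
have sRG : R \subset G by rewrite (subset_trans sRx) ?cycle_subG.
have [Q sylQ sRQ] := Sylow_superset sRG qR.
apply: subset_trans sRQ _; have [sQG qQ _] := and3P sylQ.
have defAQ : A <*> Q = A * Q by apply: comm_joingE; apply: permA sylQ.
have tiQO : Q :&: 'O_p(G) = 1.
  apply: coprime_TIg; rewrite coprime_sym (p'nat_coprime _ qQ) //.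
  exact: pi_p'group (pcore_pgroup p G) _.
have defA : A :=: (A <*> Q) :&: 'O_p(G) by rewrite defAQ -group_modl // tiQO mulg1.
rewrite defA normsI //; first by rewrite (subset_trans (joing_subr A Q)) ?normG.
by rewrite (subset_trans sQG) ?gFnorm.
Qed.

End SPermutable.

Section SPermutableQuotient.

Variables (p : nat) (gT : finGroupType).
Implicit Types A G M N P Q T X : {group gT}.

Lemma s_permutable_quotient G M T : T <| G -> M \subset G ->
  s_permutable G (M * T) -> s_permutable (G / T) (M / T).
Proof.
move=> nsTG sMG permMT q Qb pr_q sylQb; have [sTG nTG] := andP nsTG.
have [Q0 sylQ0] := Sylow_exists q G.
have sylQ0b := quotient_pHall (subset_trans (pHall_sub sylQ0) nTG) sylQ0.
have [_ /morphimP[y nTy Gy ->]] := Sylow_trans sylQ0b sylQb.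
rewrite /= -quotientJ // => ->; set Q := (Q0 :^ y)%G.
have sylQ : q.-Sylow(G) Q by rewrite pHallJ.
have nTQ := subset_trans (pHall_sub sylQ) nTG.
have nTM := subset_trans sMG nTG.
have -> : M / T = M * T / T by rewrite quotientMidr.
have nTMT : M * T \subset 'N(T) by rewrite mul_subG ?normG.
by rewrite -!quotientMl // (permMT q Q).
Qed.

Lemma s_permutable_residual_norm G M T : prime p -> T <| G -> M \subset G ->
  p.-group M -> s_permutable G (M * T) -> p_residual p G \subset 'N(M <*> T).
Proof.
move=> pr_p nsTG sMG pM permMT; have [sTG nTG] := andP nsTG.
have nTM := subset_trans sMG nTG.
have := s_permutable_pgroup_norm pr_p (quotientS T sMG) (quotient_pgroup T pM)
  (s_permutable_quotient nsTG sMG permMT).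
rewrite /=; have -> : M / T = (M <*> T) / T by rewrite quotientYidr.
rewrite -quotient_normG; last by rewrite /normal joing_subr join_subG nTM normG.
move=> sRN; rewrite gen_subG; apply/subsetP=> x /setIdP[Gx p'x].
have nTx := subsetP nTG x Gx.
rewrite -cycle_subG -(quotientSGK (H := T)) ?cycle_subG //; last first.
  by rewrite (subset_trans (joing_subr M T)) ?normG.
rewrite quotient_cycle // cycle_subG (subsetP sRN) //; apply: mem_gen.
by rewrite inE mem_quotient // morph_p_elt.
Qed.

End SPermutableQuotient.

(** * Supplements and embeddings in quotients *)

(** The series of a supersoluble group, weakened to the form in which it passes
    to quotients and subgroups. *)
Definition hypercyclic_supplemented (gT : finGroupType) (G M : {group gT}) :=
  exists T : {group gT}, [/\ T \subset G, hypercyclic T 1 T & M * T = G].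

(** The case of a quasinormal M where the auxiliary normal subgroup T is not
    harmless: C stands for the core of M, R for the intersection of T with X, and
    W for the inverse image of the hypercenter of G / C. Only the properties used
    later are kept, because cores and hypercenters do not commute with
    quotients, whereas arbitrary C, R and W can be replaced by their images. *)
Definition hypercyclically_embedded (gT : finGroupType) (G X P M : {group gT}) :=
  exists C R W : {group gT},
    [/\ C <| G, R <| G & R \subset X] /\
    [/\ C \subset M, hypercyclic G C W, ~~ (P :&: R \subset M) & M :&: R \subset W].

Section Cases.

Variables (p : nat) (gT : finGroupType) (G X P M : {group gT}).
Hypotheses (pr_p : prime p) (nsXG : X <| G) (sylP : p.-Sylow(X) P).
Hypothesis maxM : maximal M P.

Lemma supersoluble_supplement :
  has_supersoluble_supplement G M -> hypercyclic_supplemented G M.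
Proof.
by case=> T [sTG ssT defG]; exists T; split=> //; apply: supersoluble_hypercyclic.
Qed.

(** Whether P :&: T lies in M, for the normal subgroup T witnessing
    quasinormality, decides which of its two properties is exploited: the
    s-permutability of M T, or the hypercentrality of M :&: T modulo the core. *)
Lemma Us_quasinormal_cases : Us_quasinormal G M ->
  hypercyclically_embedded G X P M \/
  exists T : {group gT},
    [/\ T <| G, P :&: T \subset M & p_residual p G \subset 'N(M <*> T)].
Proof.
have [sXG nXG] := andP nsXG; have [sPX pP _] := and3P sylP.
have sMP : M \subset P := proper_sub (maxgroupp maxM).
have sMG : M \subset G by rewrite (subset_trans sMP) // (subset_trans sPX).
case=> T [nsTG permMT sMTZ].
have [sPTM | not_sPTM] := boolP (P :&: T \subset M).
  right; exists T; split=> //; apply: s_permutable_residual_norm => //.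
  exact: pgroupS pP.
left; have nsC := gcore_normal sMG; set C := (gcore M G)%G in sMTZ nsC *.
exists C, (T :&: X)%G, (coset C @*^-1 (U_hypercenter (G / C)))%G; split.
  by split; rewrite ?normalI ?subsetIr.
split.
- exact: gcore_sub.
- have := hypercyclic_cosetpre nsC (normal1 _) (U_hypercenter_hypercyclic (G / C)%G).
  by rewrite (_ : _ @*^-1 1 = C)%G //; apply/val_inj/ker_coset.
- by rewrite setIA (setIidPl _) // subIset ?sPX.
have sMTC : M :&: T \subset 'N(C) by rewrite (subset_trans (subsetIl _ _)) //
  (subset_trans sMG) ?normal_norm.
rewrite setIA (subset_trans (subsetIl _ _)) // -sub_quotient_pre //.
by rewrite -[_ / _]quotientMidr.
Qed.

End Cases.

Lemma p_residual_quotient_sub p (gT : finGroupType) (X N : {group gT}) :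
  X \subset 'N(N) -> p_residual p (X / N) \subset p_residual p X / N.
Proof.
move=> nNX; rewrite gen_subG; apply/subsetP=> xb /setIdP[/morphimP[x nNx Xx ->] p'xb].
rewrite -(constt_p_elt p'xb) -morph_constt // mem_quotient //; apply: mem_gen.
by rewrite inE groupX ?p_elt_constt.
Qed.

Lemma sub_p_residual_quotient p (gT : finGroupType) (X N : {group gT}) :
  X \subset 'N(N) -> p_residual p X / N \subset p_residual p (X / N).
Proof.
move=> nNX; rewrite sub_quotient_pre; last first.
  exact: subset_trans (p_residual_sub p X) nNX.
suff: p_residual p X \subset (coset N @*^-1 p_residual p (X / N))%G by [].
rewrite gen_subG; apply/subsetP=> x /setIdP[Xx p'x].
have nNx := subsetP nNX x Xx; rewrite mem_morphpre //; apply: mem_gen.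
by rewrite inE mem_quotient // morph_p_elt.
Qed.

Lemma quotient_hypercyclic_supplemented (gT : finGroupType) (G M N : {group gT}) :
    N <| G -> M \subset G -> hypercyclic_supplemented G M ->
  hypercyclic_supplemented (G / N) (M / N).
Proof.
case/andP=> _ nNG sMG [T [sTG hT defG]]; exists (T / N)%G; split.
- exact: quotientS.
- exact: hypercyclic_quotient1 (subset_trans sTG nNG) hT.
by rewrite -quotientMl ?defG // (subset_trans sMG).
Qed.

Section QuotientSylow.

Variables (p : nat) (gT : finGroupType) (G X P N M : {group gT}).
Hypotheses (nsXG : X <| G) (sylP : p.-Sylow(X) P).
Hypotheses (nsNG : N <| G) (sNX : N \subset X).

Let sXG : X \subset G. Proof. exact: normal_sub. Qed.
Let sPX : P \subset X. Proof. exact: pHall_sub sylP. Qed.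
Let nNX : X \subset 'N(N). Proof. exact: subset_trans (normal_norm nsNG). Qed.
Let nNP : P \subset 'N(N). Proof. exact: subset_trans nNX. Qed.

(** Both sides are Sylow p-subgroups of R N / N. Without the Sylow hypothesis,
    images do not commute with intersections. *)
Lemma Sylow_quotientI (R : {group gT}) :
  R <| X -> (P / N) :&: (R / N) = (P :&: R) / N.
Proof.
move=> nsRX; have nNRP : R :&: P \subset 'N(N) by rewrite subIset // nNP orbT.
have syl1 := quotient_pHall nNRP (Sylow_setI_normal nsRX sylP).
have syl2 := Sylow_setI_normal (quotient_normal N nsRX) (quotient_pHall nNP sylP).
rewrite setIC [P :&: R]setIC; apply: (sub_pHall syl1 (pHall_pgroup syl2)).
  exact: quotientI.
exact: pHall_sub syl2.
Qed.

Hypotheses (sMP : M \subset P) (sPNM : P :&: N \subset M).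

Lemma quotient_hypercyclically_embedded :
  hypercyclically_embedded G X P M ->
  hypercyclically_embedded (G / N) (X / N) (P / N) (M / N).
Proof.
case=> C [R [W [[nsCG nsRG sRX] [sCM hCW not_sPRM sMRW]]]].
have nsRX : R <| X := normalS sRX sXG nsRG.
have lift_M x m : x \in P -> m \in M -> coset N x = coset N m -> x \in M.
  move=> Px Mm eqxm; have Pm := subsetP sMP m Mm.
  rewrite -(groupMr _ (groupVr Mm)) (subsetP sPNM) // inE groupM ?groupV //=.
  apply: coset_idr; first by rewrite (subsetP nNP) // groupM ?groupV.
  by rewrite morphM ?morphV ?groupV ?(subsetP nNP) //= eqxm mulgV.
exists (C / N)%G, (R / N)%G, (W / N)%G; split.
  by rewrite !quotient_normal ?quotientS.
split; rewrite ?quotientS //=.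
- by apply: hypercyclic_quotient; rewrite ?normal_norm.
- rewrite Sylow_quotientI //; apply: contra not_sPRM => sPRM.
  apply/subsetP=> x PRx; have /setIP[Px _] := PRx.
  have /morphimP[m _ Mm] := subsetP sPRM _ (mem_quotient N PRx).
  exact: lift_M.
apply/subsetP=> xb /setIP[Mxb Rxb].
have : xb \in (P / N) :&: (R / N) by rewrite inE Rxb (subsetP (quotientS N sMP)).
rewrite Sylow_quotientI // => /morphimP[x nNx /setIP[Px Rx] def_xb].
case/morphimP: Mxb => m nNm Mm; rewrite def_xb => /(lift_M x m Px Mm) Mx.
by rewrite mem_quotient // (subsetP sMRW) // inE Mx.
Qed.

Lemma quotient_Sylow_residual :
  P :&: p_residual p X \subset M -> (P / N) :&: p_residual p (X / N) \subset M / N.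
Proof.
move=> sPRM; apply: subset_trans (setIS _ (p_residual_quotient_sub p nNX)) _.
by rewrite Sylow_quotientI ?p_residual_normal ?quotientS.
Qed.

End QuotientSylow.

Lemma maximal_quotient_lift (p : nat) (gT : finGroupType) (P N : {group gT})
  (Mb : {group coset_of N}) :
    p.-group P -> P \subset 'N(N) -> maximal Mb (P / N) ->
  exists M : {group gT}, [/\ maximal M P, P :&: N \subset M & Mb = (M / N)%G].
Proof.
move=> pP nNP maxMb; have sMbP := proper_sub (maxgroupp maxMb).
have defMb : (P :&: coset N @*^-1 Mb) / N = Mb.
  by rewrite quotient_setIpre (setIidPr sMbP).
have sPNM : P :&: N \subset P :&: coset N @*^-1 Mb by rewrite setIS ?sub_cosetpre.
exists (P :&: coset N @*^-1 Mb)%G; split=> //; last exact/esym/val_inj.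
have iMb := p_maximal_index (quotient_pgroup N pP) maxMb.
have pr_p : prime p.
  have : p.-group (P / N) := quotient_pgroup N pP.
  case/pgroup_pdiv => //; apply: contraTneq maxMb => -> .
  by apply/negP=> /maxgroupp/proper_card; rewrite cards1 ltnNge cardG_gt0.
apply: (p_index_maximal (subsetIl _ _)).
by rewrite -(index_quotient_eq sPNM (subsetIl _ _) nNP) defMb iMb.
Qed.

(** * A criterion for p-nilpotence *)

Section PNilpotence.

Variables (p : nat) (gT : finGroupType) (G X P : {group gT}).
Hypotheses (pr_p : prime p) (nsXG : X <| G) (geX : (primes_ge p).-group X).
Hypothesis sylP : p.-Sylow(X) P.

(** The trichotomy for M as it is used in the inductive criterion below; unlike
    the quasinormality of M, it passes to quotients of G. *)
Definition p_nilpotence_cond (M : {group gT}) :=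
  [\/ hypercyclic_supplemented G M, hypercyclically_embedded G X P M
    | P :&: p_residual p X \subset M].

Let sXG : X \subset G. Proof. exact: normal_sub. Qed.
Let sPX : P \subset X. Proof. exact: pHall_sub sylP. Qed.
Let pP : p.-group P. Proof. exact: pHall_pgroup sylP. Qed.

(** If T is a supersoluble supplement of M, then T :&: X has p-power index in
    X, has a Sylow tower, and no prime below p divides its order: its normal
      p-complement K is a
    Hall p'-subgroup of X. The normaliser of K contains T :&: P, which together
    with M generates P. *)
Lemma supplement_Hall (M : {group gT}) : maximal M P -> hypercyclic_supplemented G M ->
  exists K : {group gT},
    [/\ p^'.-Hall(X) K, Sylow_tower K & ~~ ('N_P(K) \subset M)].
Proof.
move=> maxM [T [sTG hT defG]]; have [sMP not_sPM] := andP (maxgroupp maxM).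
pose Y := (X :&: T)%G; have sMX := subset_trans sMP sPX.
have nsYT : Y <| T by rewrite /normal subsetIr normsI ?normG // (subset_trans
  sTG) // normal_norm.
have towY : Sylow_tower Y.
  apply: hypercyclic_Sylow_tower.
  have := hypercyclic_setI (normal1 T) (normal_sub nsYT) (normal_refl Y) hT.
  rewrite (_ : 1 :&: Y = 1)%G; last by apply/val_inj/setIidPl/sub1G.
  by rewrite (_ : T :&: Y = Y)%G //; apply/val_inj/setIidPr/normal_sub.
have hallK := Sylow_tower_p_nilpotent (pgroupS (subsetIl X T) geX) towY.
have [sKY p'K p_i] := and3P hallK.
exists 'O_p^'(Y)%G; split.
- rewrite /pHall p'K (subset_trans sKY) ?subsetIl //=.
  rewrite -(Lagrange_index (subsetIl X T) sKY) pnatM p_i andbT pnatNK.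
  have -> : #|X : Y| = #|M : Y|.
    apply/eqP; rewrite -(eqn_pmul2l (cardG_gt0 Y)) Lagrange ?subsetIl // LagrangeMl.
    have -> : X :=: M * Y by rewrite /= (setIC X T) group_modl // defG (setIidPr sXG).
    by rewrite -card_invg invMg !invGid.
  by apply: pnat_dvd (dvdn_indexg M Y) _; apply: pgroupS pP.
- move=> n; have piK : (primes_gt n).-Hall('O_p^'(Y)) ('O_p^'(Y) :&:
  'O_(primes_gt n)(Y)).
    by rewrite setIC (setI_normal_Hall (pcore_normal _ _) (towY n)) ?pcore_sub.
  apply: normal_Hall_pcore_Hall piK _.
  exact: normalGI (pcore_sub _ _) (pcore_normal _ _).
apply: contra not_sPM => sNM.
have -> : P :=: M * (P :&: T) by rewrite setIC group_modl // defG (setIidPr _)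
  // (subset_trans sPX).
rewrite mul_subG // (subset_trans _ sNM) // setIS //.
exact: (gFnorm_trans _ (normal_norm nsYT)).
Qed.

Lemma p_complement_mul (K : {group gT}) : p^'.-Hall(X) K -> P * K = X.
Proof.
case/and3P=> sKX p'K p_i; apply/eqP; rewrite eqEcard mul_subG //=.
rewrite coprime_cardMg ?(pnat_coprime pP) // (card_Hall sylP).
rewrite [#|K|](@card_Hall _ p^' X) ?partnC ?cardG_gt0 //.
by rewrite /pHall sKX p'K.
Qed.

Lemma subnorm_p_complementJ K x : x \in P -> 'N_P(K :^ x) = 'N_P(K) :^ x.
Proof. by move=> Px; rewrite conjIg normJ (conjGid Px). Qed.

Lemma maximal_norm_conj (M A : {set gT}) x : x \in P -> P \subset 'N(M) ->
  (A :^ x \subset M) = (A \subset M).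
Proof. by move=> Px nMP; rewrite -{1}(normsP nMP x Px) conjSg. Qed.

(** When no nontrivial normal subgroup of G inside X is a p-group or a p'-group,
    the embedded case cannot occur. If every M contains P :&: O^p(X), then X is
    p-nilpotent by the theorem of Tate. Otherwise there is a Hall p'-subgroup K with a
    Sylow tower, and a maximal subgroup M containing N_P(K) would be excluded
    in each of the two remaining cases, so P normalises K. *)
Lemma p_nilpotent_trivial_cores :
    (forall M : {group gT}, maximal M P -> p_nilpotence_cond M) ->
    (forall N : {group gT}, N <| G -> N \subset X ->
       p.-group N || p^'.-group N -> N :=: 1) ->
  p_nilpotent p X.
Proof.
move=> condP min1; pose R := [group of p_residual p X].
have [sRX nRX] := andP (p_residual_normal p X).
have no_embed (M : {group gT}) : maximal M P -> ~ hypercyclically_embedded G X P M.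
  move=> maxM [C [S [W [[nsCG nsSG sSX] [sCM hCW not_sPSM sMSW]]]]].
  have sMP := proper_sub (maxgroupp maxM).
  (* Being contained in M, the subgroup C is a p-group. If W met S, then S would
     contain a normal subgroup of G of prime order; so M :&: S = 1, and the
     Sylow p-subgroups of S have order p. Hence S is p-nilpotent, which leaves
     only the trivial group. *)
  have C1 : C = 1%G.
    apply/val_inj/min1 => //=; first by rewrite (subset_trans sCM) ?(subset_trans sMP).
    by rewrite (pgroupS _ pP) // (subset_trans sCM).
  have tiMS : M :&: S = 1.
    have [tiSW | ntSW] := eqVneq (S :&: W) 1.
      by apply/trivgP; rewrite -tiSW subsetI subsetIr.
    have tiSC : S :&: C = 1 by rewrite C1; apply/setIidPr/sub1G.
    have [Z [nsZG sZS prZ]] := hypercyclic_meet_prime nsCG nsSG hCW tiSC ntSW.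
    have := min1 Z nsZG (subset_trans sZS sSX); rewrite /pgroup !pnatE // !inE orbN.
    by move/(_ isT)=> Z1; rewrite Z1 cards1 in prZ.
  have defP : M * (P :&: S) = P.
    by apply: mulg_normal_maximal; rewrite ?(p_maximal_normal pP) ?subsetIl.
  have sylPS := Sylow_setI_normal (normalS sSX sXG nsSG) sylP.
  have oPS : #|S :&: P| = p.
    have tiMPS : M :&: (P :&: S) = 1.
      by apply/trivgP; rewrite -tiMS setIS ?subsetIr.
    rewrite -(p_maximal_index pP maxM) -divgS // -{2}defP TI_cardMg //.
    by rewrite mulKn // setIC.
  have cycPS : cyclic (S :&: P) by rewrite prime_cyclic ?oPS.
  have nilS := cyclic_Sylow_p_nilpotent pr_p (pgroupS sSX geX) sylPS cycPS.
  have O1 : 'O_p^'(S) = 1.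
    apply: (min1 'O_p^'(S)%G); rewrite ?(subset_trans (pcore_sub _ _)) //.
      exact: gFnormal_trans.
    by rewrite pcore_pgroup orbT.
  have pS : p.-group S.
    by have := nilS; rewrite /p_nilpotent O1 => /and3P[_ _]; rewrite indexg1 pnatNK.
  have S1 : S :=: 1 by rewrite (min1 S) ?pS.
  by case/negP: not_sPSM; rewrite S1 (subset_trans (subsetIr _ _)) ?sub1G.
have [cP|] := boolP [forall M : {group gT}, maximal M P ==> (P :&: R \subset M)].
  rewrite p_nilpotentE // -/R -p_residual_id -p_nilpotentE //.
  apply: (Tate pr_p sylP (p_residual_normal p X)); apply/bigcapsP=> M.
  case/predU1P=> [-> | maxM]; first exact: subsetIr.
  by rewrite setIC (implyP (forallP cP M)).
case/forallPn=> M0; rewrite negb_imply => /andP[maxM0 not_sDM0].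
case: (condP M0 maxM0) => [supM0|/no_embed[]//|sDM0]; last by rewrite sDM0 in not_sDM0.
have [K [hallK towK _]] := supplement_Hall maxM0 supM0.
have [sKX p'K _] := and3P hallK.
have sKR : K \subset R by apply: p'_sub_residual.
(* A Frattini argument: for x in P, the subgroups K and K :^ x are Hall subgroups
   of R with Sylow towers, hence conjugate in R, and N_X(K) = N_P(K) K. *)
have defP : P \subset 'N_P(K) * (P :&: R).
  apply/subsetP=> x Px; have Xx := subsetP sPX x Px.
  have hallKR : p^'.-Hall(R) K := pHall_subl sKR sRX hallK.
  have hallKxR : p^'.-Hall(R) (K :^ x).
    by rewrite pHallJnorm // (subsetP nRX).
  have [e Re defKe] := Sylow_tower_Hall_trans hallKR hallKxR towK (Sylow_towerJ x towK).
  have nKxe : x * e^-1 \in 'N_X(K).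
    apply/setIP; split; first by rewrite groupM // groupV; apply: (subsetP sRX).
    by apply/normP; rewrite conjsgM defKe conjsgK.
  have : 'N_X(K) \subset 'N_P(K) * K.
    rewrite (setIC P) group_modr ?normG // (p_complement_mul hallK).
    by rewrite subsetI subsetIr subsetIl.
  move/subsetP/(_ _ nKxe)/mulsgP=> [y k Ny Kk def_xe].
  have def_x : x = y * (k * e) by rewrite mulgA -def_xe mulgKV.
  rewrite def_x; apply: mem_mulg => //; apply/setIP; split;
    last by rewrite groupM // (subsetP sKR).
  have Py : y \in P by case/setIP: Ny.
  by rewrite -(groupMl _ Py) -def_x.
have [eqN | [M maxM sNM]] := maximal_exists (subsetIl P 'N(K)).
  have nKP : P \subset 'N(K) by apply/setIidPl.
  apply: (normal_Hall_p_nilpotent _ hallK).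
  by rewrite /normal sKX -(p_complement_mul hallK) mul_subG ?normG.
have [_ not_sPM] := andP (maxgroupp maxM).
have nMP := normal_norm (p_maximal_normal pP maxM).
case: (condP M maxM) => [supM|/no_embed[]//|sDM]; last first.
  by case/negP: not_sPM; apply: subset_trans defP _; rewrite mul_subG.
have [K' [hallK' towK' not_sNM]] := supplement_Hall maxM supM.
(* K' is conjugate to K by an element of P, because X = P K; but then N_P(K')
   is conjugate to N_P(K) under P and lies in the normal subgroup M. *)
have [x Xx defK'] := Sylow_tower_Hall_trans hallK hallK' towK towK'.
have : x^-1 \in P * K by rewrite (p_complement_mul hallK) groupV.
case/mulsgP=> y k Py Kk /(canRL invgK); rewrite invMg => def_x.
case/negP: not_sNM; rewrite defK' def_x conjsgM (conjGid (groupVr Kk)).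
by rewrite subnorm_p_complementJ ?maximal_norm_conj ?groupV.
Qed.

(** Let K1 / N be the normal p-complement of X / N, and K a complement of N in
    K1. Since G = N N_G(K), the subgroup C_N(K) is normal in G. If it is N, then K
    is normal in X. If it is trivial, P is the semidirect product of N and
    P1 = N_P(K), and a maximal subgroup M of P containing P1 does not contain N;
    each of the three cases for M is contradictory or shows that K centralises
    N. *)
Lemma p_nilpotent_minnormal_pgroup (N : {group gT}) :
    (forall M : {group gT}, maximal M P -> p_nilpotence_cond M) ->
    (forall L : {group gT}, L <| G -> L \subset X -> p^'.-group L -> L :=: 1) ->
    minnormal N G -> N \subset X -> p.-group N -> p_nilpotent p (X / N) ->
  p_nilpotent p X.
Proof.
move=> condP min1 minN sNX pN nilXN.
have [/andP[ntN nNG] minN_eq] := mingroupP minN.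
have nsNG : N <| G by rewrite /normal (subset_trans sNX).
have nsNX : N <| X := normalS sNX sXG nsNG.
have nNX := normal_norm nsNX.
have /is_abelemP[q pr_q abelN] : is_abelem N.
  by have [_ _] := minnormal_solvable minN (subxx _) (pgroup_sol pN).
have abN := abelem_abelian abelN.
have minN_cases (L : {group gT}) : G \subset 'N(L) -> L :&: N = 1 \/ N \subset L.
  move=> nLG; have [|ntLN] := eqVneq (L :&: N) 1; first by left.
  right; rewrite -(minN_eq (L :&: N)%G) ?subsetIl ?subsetIr // ntLN /=.
  exact: normsI.
have sNP : N \subset P := subset_trans (pcore_max pN nsNX) (pcore_sub_Hall sylP).
pose OXN := 'O_p^'(X / N)%G.
have nsOG : OXN <| G / N by apply: gFnormal_trans; rewrite quotient_normal.
have [K1 /= defK1 sNK1 nsK1G] := inv_quotientN nsNG nsOG.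
have sK1X : K1 \subset X by rewrite -(quotientSGK _ sNX) ?(subset_trans
  (normal_sub nsK1G) nNG) // -defK1 pcore_sub.
have nNK1 := subset_trans sK1X nNX.
have nsNK1 : N <| K1 by apply/andP.
have p'K1N : p^'.-group (K1 / N) by rewrite -defK1 pcore_pgroup.
have hallN : p.-Hall(K1) N.
  by rewrite /pHall sNK1 pN -card_quotient.
have [K /complP[tiNK defNK]] := splitsP (SchurZassenhaus_split (pHall_Hall
  hallN) nsNK1).
have sKK1 : K \subset K1 by rewrite -defNK mulG_subr.
have sKX := subset_trans sKK1 sK1X.
have coNK : coprime #|N| #|K|.
  rewrite (pnat_coprime pN) //; have := p'K1N.
  by rewrite /pgroup card_quotient // -divgS // -defNK TI_cardMg // mulKn.
have p'K : p^'.-group K.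
  by rewrite (isog_pgroup _ (quotient_isog (subset_trans sKX nNX) tiNK))
    (pgroupS _ p'K1N) ?quotientS.
have hallK : p^'.-Hall(X) K.
  rewrite /pHall sKX p'K -(Lagrange_index sK1X sKK1) pnatM !pnatNK.
  have -> : p.-nat #|X : K1|.
    rewrite -(index_quotient_eq _ sK1X nNX) ?subIset ?sNK1 ?orbT // -defK1.
    by case/and3P: nilXN => _ _; rewrite pnatNK.
  by rewrite -divgS // -defNK TI_cardMg // mulnK.
have nNK : K \subset 'N(N) := subset_trans sKX nNX.
(* Complements of N in K1 are conjugate under N. *)
have Frattini : N * 'N_G(K) = G.
  apply/eqP; rewrite eqEsubset mul_subG ?(normal_sub nsNG) ?subsetIl //=.
  apply/subsetP=> g Gg.
  have sKgK1 : K :^ g \subset N * K.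
    by rewrite defNK -(normsP (normal_norm nsK1G) g Gg) conjSg.
  have [x Nx defKg] := SchurZassenhaus_trans_sol (pgroup_sol pN) nNK sKgK1 coNK
    (cardJg K g).
  have nKgx : g * x^-1 \in 'N_G(K).
    apply/setIP; split; first by rewrite groupM // groupV (subsetP (normal_sub nsNG)).
    by apply/normP; rewrite conjsgM defKg conjsgK.
  have nNgx : (g * x^-1) \in 'N(N).
    by case/setIP: nKgx => Ggx _; rewrite (subsetP nNG).
  rewrite -[g](mulgKV x) -normC ?mem_mulg //.
  by rewrite subIset ?nNG.
have caseN : K \subset 'C(N) -> p_nilpotent p X.
  move=> cNK; apply: (normal_Hall_p_nilpotent _ hallK).
  rewrite /normal sKX (subset_trans sXG) // -Frattini mul_subG ?subsetIr //.
  by rewrite cents_norm // centsC.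
have tiNNK : 'N_N(K) = 1 \/ p_nilpotent p X.
  rewrite coprime_norm_cent //.
  have [|h|h] := minN_cases 'C_N(K)%G; last 2 first.
  - by left; rewrite -h; apply/esym/setIidPl/subsetIl.
  - by right; apply: caseN; rewrite centsC (subset_trans h) ?subsetIr.
  rewrite -{1}Frattini mul_subG //=.
    by rewrite cents_norm // centsC (subset_trans (subsetIl _ _)).
  apply: normsI; first by rewrite subIset ?nNG.
  exact: subset_trans (subsetIr _ _) (cent_norm _).
case: tiNNK => // tiNNK; set P1 := 'N_P(K)%G.
have defP : N * P1 = P.
  have sPG := subset_trans sPX sXG.
  have -> : P1 :=: 'N_G(K) :&: P by rewrite /= setIAC (setIidPr sPG).
  by rewrite group_modl // Frattini (setIidPr sPG).
have tiNP1 : N :&: P1 = 1 by rewrite /= setIA (setIidPl sNP).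
have [eqP1 | [M maxM sP1M]] := maximal_exists (subsetIl P 'N(K)).
  by case/negP: ntN; rewrite -subG1 -tiNP1 subsetI subxx /= eqP1.
have [sMP not_sPM] := andP (maxgroupp maxM).
have not_sNM : ~~ (N \subset M).
  by apply: contra not_sPM => sNM; rewrite -defP mul_subG.
have nMP := normal_norm (p_maximal_normal pP maxM).
case: (condP M maxM) => [supM | [C [R [W [[nsCG nsRG sRX] [sCM hCW not_sPRM
  sMRW]]]]] | sDM].
- have [K2 [hallK2 _ not_sNK2]] := supplement_Hall maxM supM.
  have [sK2X p'K2 _] := and3P hallK2.
  have sK2K1 : K2 \subset N * K.
    rewrite defNK -(quotientSGK _ sNK1) ?(subset_trans sK2X) // -defK1.
    by rewrite (sub_Hall_pcore nilXN) ?quotientS // quotient_pgroup.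
  have eqK2 : #|K2| = #|K| by rewrite (card_Hall hallK2) (card_Hall hallK).
  have [x Nx defK2] := SchurZassenhaus_trans_sol (pgroup_sol pN) nNK sK2K1 coNK eqK2.
  have Px := subsetP sNP x Nx; case/negP: not_sNK2.
  by rewrite defK2 subnorm_p_complementJ ?maximal_norm_conj.
- have [tiCN | sNC] := minN_cases C (normal_norm nsCG); last first.
    by case/negP: not_sNM; apply: subset_trans sCM.
  (* If R avoids N, then R :&: K1 is a normal p'-subgroup, hence trivial, and K
     commutes with R; this puts P :&: R inside P1, hence inside M. If R contains
     N, then N is cyclic of order p, and p is too small for K to act on it. *)
  have [tiRN | sNR] := minN_cases R (normal_norm nsRG).
    have defN : P :&: K1 = N.
      have sylK1 := Sylow_setI_normal (normalS sK1X sXG nsK1G) sylP.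
      rewrite setIC; apply: (sub_pHall hallN (pHall_pgroup sylK1)).
        by rewrite subsetI sNK1.
      exact: subsetIl.
    have RK1 : R :&: K1 = 1.
      apply: (min1 (R :&: K1)%G); rewrite ?normalI ?subIset ?sRX //.
      have nsRK1 : R :&: K1 <| X by rewrite (normalS _ sXG) ?normalI ?subIset ?sRX.
      rewrite -partG_eq1 -(card_Hall (Sylow_setI_normal nsRK1 sylP)) -trivg_card1.
      by rewrite /= -setIA (setIC K1) defN tiRN.
    case/negP: not_sPRM; apply: subset_trans sP1M; apply: setIS.
    rewrite cents_norm // (sameP commG1P trivgP) -RK1 subsetI.
    apply/andP; split.
      by rewrite commg_subl (subset_trans sKX) // (subset_trans sXG) ?normal_norm.
    rewrite (subset_trans (commgS _ sKK1)) // commg_subr.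
    by rewrite (subset_trans sRX) // (subset_trans sXG) ?normal_norm.
  have cycN : cyclic N.
    have [tiNW | ntNW] := eqVneq (N :&: W) 1; last first.
      by apply: hypercyclic_minnormal hCW _ ntNW;
        rewrite // ?(normal_sub nsNG) // setIC.
    have tiMN : M :&: N = 1.
      by apply/trivgP; rewrite -tiNW subsetI subsetIr (subset_trans _ sMRW) ?setIS.
    have defP' : M * N = P.
      by apply: mulg_normal_maximal; rewrite ?(p_maximal_normal pP).
    apply: prime_cyclic; rewrite -(mulKn #|N| (cardG_gt0 M)) -TI_cardMg // defP'.
    by rewrite divgS // (p_maximal_index pP).
  have oN : #|N| = p.
    have oNq := cyclic_abelem_prime abelN cycN ntN.
    by move: pN; rewrite /pgroup oNq pnatE // inE => /eqP.
  by apply: caseN; apply: subset_trans sKX _; apply: primes_ge_cent_prime; rewrite ?oN.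
have nRG : G \subset 'N(p_residual p X).
  exact: subset_trans (normal_norm nsXG) (p_residual_norm p X).
have sRN : [~: N, p_residual p X] \subset N.
  by rewrite commg_subl (subset_trans (p_residual_sub p X)).
have sRR : [~: N, p_residual p X] \subset p_residual p X.
  by rewrite commg_subr (subset_trans sNX) ?normal_norm ?p_residual_normal.
have [|tiNR|sNR] := minN_cases [~: N, p_residual p X]%G; first exact: normsR.
  apply: caseN; apply: subset_trans (p'_sub_residual sKX p'K) _.
  by apply/commG1P; rewrite commGC -tiNR; apply/esym/setIidPl.
case/negP: not_sNM; apply: subset_trans sNR _; apply: subset_trans sDM.
by rewrite subsetI (subset_trans sRN).
Qed.

End PNilpotence.

Lemma normal_p'_p_nilpotent p (gT : finGroupType) (X N : {group gT}) :
    prime p -> N <| X -> p^'.-group N -> p_nilpotent p (X / N) ->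
  p_nilpotent p X.
Proof.
move=> pr_p /andP[sNX nNX] p'N; rewrite !p_nilpotentE // => p'R.
rewrite -(pquotient_pgroup p'N) ?(subset_trans (p_residual_sub p X)) //.
exact: pgroupS (sub_p_residual_quotient p nNX) p'R.
Qed.

(** Induction on |G|: normal p'-subgroups can be factored out, the
    quotient by a minimal normal p-subgroup is p-nilpotent by induction, and the
    two lemmas above deal with the cases O_p(X) <> 1 and O_p(X) = 1. *)
Theorem p_nilpotence_criterion p (gT : finGroupType) (G X P : {group gT}) :
    prime p -> X <| G -> (primes_ge p).-group X -> p.-Sylow(X) P ->
    (~~ cyclic P -> forall M : {group gT}, maximal M P -> p_nilpotence_cond p G
      X P M) ->
  p_nilpotent p X.
Proof.
move=> pr_p; have [m] := ubnP #|G|.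
elim: m => // m IH in gT G X P * => leGm nsXG geX sylP condP.
have [cycP | ncycP] := boolP (cyclic P).
  exact: cyclic_Sylow_p_nilpotent cycP.
have {}condP := condP ncycP; have [sXG nXG] := andP nsXG.
have [sPX pP _] := and3P sylP.
have nilXN (N : {group gT}) : N <| G -> N \subset X -> N :!=: 1 -> p_nilpotent
  p (X / N).
  move=> nsNG sNX ntN; have nNX := subset_trans sXG (normal_norm nsNG).
  have nNP := subset_trans sPX nNX.
  apply: (IH _ (G / N)%G (X / N)%G (P / N)%G);
    rewrite ?quotient_normal ?quotient_pgroup //.
  - by apply: leq_trans (ltn_quotient ntN (normal_sub nsNG)) _.
  - exact: quotient_pHall.
  move=> _ _ /(maximal_quotient_lift pP nNP)[M [maxM sPNM ->]].
  have sMP := proper_sub (maxgroupp maxM).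
  case: (condP M maxM) => [supM | embM | sDM].
  - apply: Or31; apply: (quotient_hypercyclic_supplemented nsNG _ supM).
    by rewrite (subset_trans sMP) ?(subset_trans sPX).
  - apply: Or32; exact: (quotient_hypercyclically_embedded nsXG sylP nsNG sMP
    sPNM embM).
  by apply: Or33; exact: (quotient_Sylow_residual nsXG sylP nsNG sDM).
have [exN | no_p'] := boolP [exists N : {group gT}, [&& N <| G, N \subset X,
  p^'.-group N & N :!=: 1]].
  have [N /and4P[nsNG sNX p'N ntN]] := existsP exN.
  apply: (@normal_p'_p_nilpotent _ _ _ N); rewrite ?nilXN //.
  exact: normalS nsNG.
have {}no_p' (N : {group gT}) : N <| G -> N \subset X -> p^'.-group N -> N :=: 1.
  move=> nsNG sNX p'N; apply/eqP; apply: contraNT no_p' => ntN.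
  by apply/existsP; exists N; rewrite nsNG sNX p'N.
have [Op1 | ntOp] := eqVneq 'O_p(X) 1.
  apply: (p_nilpotent_trivial_cores pr_p nsXG geX sylP condP) => N nsNG sNX.
  case/orP=> [pN | ]; last exact: no_p'.
  by apply/trivgP; rewrite -Op1 pcore_max // (normalS sNX sXG).
have nOG : G \subset 'N('O_p(X)) by rewrite (subset_trans nXG) ?gFnorms.
have [N minN sNO] := minnormal_exists ntOp nOG.
have sNX := subset_trans sNO (pcore_sub p X).
have [/andP[ntN nNG] _] := mingroupP minN.
apply: (p_nilpotent_minnormal_pgroup pr_p nsXG geX sylP condP no_p' minN) => //.
  exact: pgroupS sNO (pcore_pgroup p X).
by apply: nilXN; rewrite // /normal (subset_trans sNX).
Qed.

(** * Solubility *)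

(** The property required of F*(H), stated for an arbitrary X because it is
    passed on to the normal p-complement of X. *)
Definition maximal_Sylow_cond (gT : finGroupType) (G X : {group gT}) : Prop :=
  forall (p : nat) (P M : {group gT}),
    prime p -> p.-Sylow(X) P -> ~~ cyclic P -> maximal M P ->
  ~ has_supersoluble_supplement G M -> Us_quasinormal G M.

Section Residual.

Variables (p : nat) (gT : finGroupType) (G X P M T : {group gT}).
Hypotheses (pr_p : prime p) (nsXG : X <| G) (geX : (primes_ge p).-group X).
Hypotheses (sylP : p.-Sylow(X) P) (maxM : maximal M P) (nsTG : T <| G).
Hypotheses (sPTM : P :&: T \subset M) (nMTR : p_residual p G \subset 'N(M <*> T)).

(** The subgroup B = M T :&: X is normalised both by O^p(X) and by P, hence by X, and
    meets P in M. So X / B has Sylow p-subgroups of order p, and is p-nilpotent: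
    the image of O^p(X) in it is a p'-group. *)
Lemma Sylow_residual_maximal : P :&: p_residual p X \subset M.
Proof.
have [sXG nXG] := andP nsXG; have [sPX pP _] := and3P sylP.
have sMP := proper_sub (maxgroupp maxM); have sMX := subset_trans sMP sPX.
have nTX := subset_trans sXG (normal_norm nsTG).
have nMP := normal_norm (p_maximal_normal pP maxM).
pose B := ((M <*> T) :&: X)%G.
have defPB : P :&: B = M.
  rewrite /= setIA norm_joinEl ?(subset_trans sMX) // setIC setIA (setIidPr sPX).
  rewrite setIC -group_modl // setIC.
  by apply/eqP; rewrite eqEsubset mulG_subl mul_subG.
have nsBX : B <| X.
  rewrite /normal subsetIr -{1}(p_residual_Sylow pr_p sylP) mul_subG //.
    apply: normsI; first exact: subset_trans (p_residualS p sXG) nMTR.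
    by rewrite (subset_trans (p_residual_sub p X)) ?normG.
  apply: normsI; last exact: subset_trans (normG X).
  by rewrite normsY // (subset_trans sPX).
have nBX := normal_norm nsBX; have nBP := subset_trans sPX nBX.
have sylPB : p.-Sylow(X / B) (P / B) by apply: quotient_pHall.
have cycPB : cyclic (P / B).
  apply: prime_cyclic; rewrite card_quotient // -indexgI defPB.
  by rewrite (p_maximal_index pP maxM).
have := cyclic_Sylow_p_nilpotent pr_p (quotient_pgroup B geX) sylPB cycPB.
rewrite p_nilpotentE // => p'RB.
rewrite -defPB subsetI subsetIl /=.
have nBPR : P :&: p_residual p X \subset 'N(B) by rewrite subIset ?nBP.
rewrite -quotient_sub1 // subG1 trivg_card1 -dvdn1.
have pPRB : p.-group ((P :&: p_residual p X) / B).
  by rewrite quotient_pgroup // (pgroupS (subsetIl _ _) pP).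
have p'PRB : p^'.-group ((P :&: p_residual p X) / B).
  apply: pgroupS p'RB; apply: subset_trans (sub_p_residual_quotient p nBX).
  by rewrite quotientS ?subsetIr.
by rewrite -(eqnP (pnat_coprime pPRB p'PRB)) gcdnn.
Qed.

End Residual.

(** For p the smallest prime divisor of |X| there is a normal p-complement; its
    Sylow subgroups are Sylow subgroups of X, so that it satisfies the same
    condition. *)
Theorem maximal_Sylow_cond_solvable (gT : finGroupType) (G X : {group gT}) :
  X <| G -> maximal_Sylow_cond G X -> solvable X.
Proof.
have [m] := ubnP #|X|; elim: m => // m IH in X * => leXm nsXG condX.
have [X1 | ntX] := eqVneq (X : {set gT}) 1; first by rewrite X1 solvable1.
pose p := pdiv #|X|; have pr_p : prime p by rewrite pdiv_prime // cardG_gt1.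
have geX : (primes_ge p).-group X.
  by apply/pgroupP=> q pr_q qX; rewrite inE pdiv_min_dvd ?prime_gt1.
have [P sylP] := Sylow_exists p X.
have nilX : p_nilpotent p X.
  apply: (p_nilpotence_criterion pr_p nsXG geX sylP) => ncycP M maxM.
  have [/asboolP ss|/asboolP no_ss] := boolP `[< has_supersoluble_supplement G M >].
    by apply: Or31; apply: supersoluble_supplement.
  have Us := condX p P M pr_p sylP ncycP maxM no_ss.
  have [emb | [T [nsTG sPTM nMTR]]] := Us_quasinormal_cases pr_p nsXG sylP maxM Us.
    exact: Or32.
  by apply: Or33; apply: (Sylow_residual_maximal pr_p nsXG geX sylP maxM nsTG).
have nsKX : 'O_p^'(X) <| X := pcore_normal _ _.
rewrite (series_sol nsKX); apply/andP; split; last first.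
  apply: (pgroup_sol (p := p)); rewrite /pgroup card_quotient ?normal_norm //.
  by have /and3P[_ _] := nilX; rewrite pnatNK.
apply: IH.
- apply: leq_trans (ltnSE leXm); rewrite ltnNge; apply/negP=> leXK.
  have eqK : 'O_p^'(X) = X by apply/eqP; rewrite eqEcard pcore_sub.
  have := pgroupP (pcore_pgroup p^' X) p pr_p; rewrite /= eqK pdiv_dvd => /(_ isT).
  by rewrite !inE eqxx.
- exact: gFnormal_trans.
move=> q Q M pr_q sylQ ncycQ; apply: (condX q Q M pr_q) => //.
apply: subHall_Sylow (nilX) _ (sylQ).
rewrite !inE; apply: contraNneq ncycQ => eq_qp.
have : p.-group Q by rewrite -eq_qp (pHall_pgroup sylQ).
move=> pQ; have p'Q : p^'.-group Q := pgroupS (pHall_sub sylQ) (pcore_pgroup _ _).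
suff -> : Q :=: 1 by apply: cyclic1.
by apply/eqP; rewrite trivg_card1 -dvdn1 -(eqnP (pnat_coprime pQ p'Q)) gcdnn.
Qed.

(** * Eigenvectors of power automorphisms *)

(** The minimal polynomial of A divides X^p - X, which is the product of all
    X - a with a in F_p. *)
Lemma Fp_eigenvalue (p n : nat) (A : 'M['F_p]_n.+1) :
  prime p -> (A ^+ p = A)%R -> exists a, eigenvalue A a.
Proof.
move=> pr_p Ap; have dvdA : Pdiv.Field.dvdp (mxminpoly A) (\prod_(x : 'F_p) ('X
  - x%:P))%R.
  apply: mxminpoly_min; rewrite -finField_genPoly card_Fp //.
  by rewrite GRing.rmorphB /= GRing.rmorphXn /= horner_mx_X Ap GRing.subrr.
have [m eqm] := dvdp_prod_XsubC dvdA.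
case: (mask m _) eqm => [|a r] eqm.
  have := eqp_size eqm; rewrite big_nil size_polyC GRing.oner_eq0 size_mxminpoly.
  by case: (degree_mxminpoly A) (mxminpoly_nonconstant A).
by exists a; rewrite eigenvalue_root_min (eqp_root eqm) root_prod_XsubC mem_head.
Qed.

Lemma cyclic_der1_cent (gT : finGroupType) (A G : {group gT}) :
  cyclic A -> G \subset 'N(A) -> G^`(1) \subset 'C(A).
Proof.
move=> cycA nAG; rewrite gen_subG; apply/subsetP=> _ /imset2P[x y Gx Gy ->].
have [nAx nAy] := (subsetP nAG x Gx, subsetP nAG y Gy).
rewrite /= -ker_conj_aut; apply/kerP; first exact: groupR.
rewrite morphR //=; apply/eqP/commgP.
apply: (centsP (Aut_cyclic_abelian cycA)).
  exact: subsetP (Aut_conj_aut A 'N(A)) _ (mem_morphim _ nAx nAx).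
exact: subsetP (Aut_conj_aut A 'N(A)) _ (mem_morphim _ nAy nAy).
Qed.

(** Aut(A) has order |A| - 1. *)
Lemma prime_exp_cent (gT : finGroupType) (A : {group gT}) g :
  prime #|A| -> g \in 'N(A) -> g ^+ #|A|.-1 \in 'C(A).
Proof.
move=> prA nAg; rewrite -ker_conj_aut; apply/kerP; first exact: groupX.
rewrite morphX // -totient_prime // -card_Aut_cyclic ?prime_cyclic //.
apply: expg_cardG; exact: subsetP (Aut_conj_aut A 'N(A)) _ (mem_morphim _ nAg nAg).
Qed.

Section PowerAutomorphisms.

Variables (p : nat) (gT : finGroupType) (E G : {group gT}).
Hypotheses (pr_p : prime p) (abelE : p.-abelem E) (minE : minnormal E G).
Hypotheses (cED : G^`(1) \subset 'C(E)) (cEX : forall g, g \in G -> g ^+ p.-1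
  \in 'C(E)).

Let nEG : G \subset 'N(E). Proof. by have /mingroupP[/andP[]] := minE. Qed.
Let ntE : E :!=: 1. Proof. by have /mingroupP[/andP[]] := minE. Qed.

Lemma exists_power_eigenvector g : g \in G ->
  exists k, exists2 v, v \in E & v != 1 /\ v ^ g = v ^+ k.
Proof.
move=> Gg; pose rG := abelem_repr abelE ntE nEG.
have Ap : (rG g ^+ p = rG g)%R.
  have rGX i : (rG g ^+ i = rG (g ^+ i)%g)%R.
    elim: i => [|i IHi]; first by rewrite GRing.expr0 repr_mx1.
    by rewrite GRing.exprS expgS repr_mxM ?groupX // IHi.
  have -> : (rG g ^+ p = rG g ^+ p.-1.+1)%R by rewrite prednK ?prime_gt0.
  rewrite GRing.exprS rGX -[RHS]GRing.mulr1.
  congr (_ * _)%R; apply/row_matrixP=> i; rewrite rowE row1.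
  apply: (can_inj (rVabelemK abelE ntE)).
  rewrite rVabelemJ ?groupX // /conjg -(centP (cEX Gg)) ?mulKg //.
  exact: mem_rVabelem.
have [a /eigenvalueP[v def_v nz_v]] := Fp_eigenvalue pr_p Ap.
exists a, (rVabelem abelE ntE v); first exact: mem_rVabelem.
split; last by rewrite -(rVabelemJ abelE ntE nEG) // -/rG def_v rVabelemZ.
by apply: contra nz_v => /eqP; rewrite -(rVabelem0 abelE ntE) => /(can_inj
  (rVabelemK abelE ntE))->.
Qed.

(** One eigenvector v is enough: G' centralises E, so the vectors on which g
    acts as the k-th power form a subgroup invariant under all of G. *)
Lemma power_automorphism g : g \in G ->
  exists k, {in E, forall v, v ^ g = v ^+ k}.
Proof.
move=> Gg; have [k [v Ev [nt_v vg]]] := exists_power_eigenvector Gg.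
have abE := abelem_abelian abelE.
pose D := [set u in E | u ^ g == u ^+ k].
have gD : group_set D.
  apply/group_setP; split; first by rewrite inE group1 conj1g expg1n eqxx.
  move=> x y /setIdP[Ex /eqP xg] /setIdP[Ey /eqP yg].
  by rewrite inE groupM //= conjMg xg yg expgMn //; apply: (centsP abE).
have [_ minE'] := mingroupP minE.
suff defD : D = E by exists k => u; rewrite -{1}defD => /setIdP[_ /eqP].
rewrite -[D]/(gval (Group gD)); apply: minE'; last by apply/subsetP=> u /setIdP[].
apply/andP; split.
  by apply/trivgPn; exists v; rewrite // inE Ev vg eqxx.
apply/subsetP=> h Gh; rewrite inE; apply/subsetP=> _ /imsetP[u /setIdP[Eu /eqP ug] ->].
rewrite inE memJ_norm ?(subsetP nEG) // Eu /=.
have cu w : w \in E -> w ^ [~ g, h] = w.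
  move=> Ew; have cw : [~ g, h] \in 'C(E) by rewrite (subsetP cED) // mem_commg.
  by rewrite /conjg -(centP cw) // mulKg.
apply/eqP; rewrite -conjXg -ug -!conjgM.
rewrite (commgC g h) [in RHS]conjgM cu //.
by rewrite conjgM memJ_norm ?(subsetP nEG) // memJ_norm ?(subsetP nEG).
Qed.

(** Every g acts as a power map, so every line of E is invariant under G. *)
Lemma minnormal_power_cyclic : cyclic E.
Proof.
have /trivgPn[v Ev nt_v] := ntE; have [_ minE'] := mingroupP minE.
suff <- : <[v]> = E by apply: cycle_cyclic.
apply: minE'; last by rewrite cycle_subG.
rewrite cycle_eq1 nt_v; apply/subsetP=> g Gg; have [k powg] := power_automorphism Gg.
by rewrite inE -cycleJ cycle_subG powg // mem_cycle.
Qed.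

End PowerAutomorphisms.

(** * Lifting from the Frattini quotient *)

(** In coprime action, fixed points of L / B lift to fixed points of L, so L is
    generated by B and C_L(A). *)
Lemma coprime_stable_cent (gT : finGroupType) (A B L : {group gT}) :
    A \subset 'N(L) -> A \subset 'N(B) -> L \subset 'N(B) ->
    coprime #|B| #|A| -> solvable B -> [~: L, A] \subset B -> A \subset 'C(B) ->
  A \subset 'C(L).
Proof.
move=> nLA nBA nBL coBA solB sLAB cBA.
have := coprime_norm_quotient_cent nLA nBA coBA solB.
have -> : 'C_(L / B)(A / B) = L / B.
  by apply/setIidPl; rewrite quotient_cents2.
move=> eqLB; rewrite centsC.
have sLBC : L \subset B * 'C_L(A).
  by rewrite -quotientSK // eqLB.
by apply: subset_trans sLBC _; rewrite mul_subG ?subsetIr // centsC.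
Qed.

(** Fixed points of P / Phi(P) lift to C_P(A), which therefore generates P
    modulo Phi(P). *)
Lemma coprime_Phi_cent (p : nat) (gT : finGroupType) (A P : {group gT}) :
    p.-group P -> p^'.-group A -> A \subset 'N(P) -> [~: P, A] \subset 'Phi(P) ->
  A \subset 'C(P).
Proof.
move=> pP p'A nPA sPAPhi; have nPhiA : A \subset 'N('Phi(P)) by rewrite
  (subset_trans nPA) ?gFnorms.
have nPhiP : P \subset 'N('Phi(P)) := gFnorm _ _.
have pPhi : p.-group 'Phi(P) := pgroupS (Phi_sub P) pP.
have := coprime_norm_quotient_cent nPA nPhiA (pnat_coprime pPhi p'A) (pgroup_sol pPhi).
have -> : 'C_(P / 'Phi(P))(A / 'Phi(P)) = P / 'Phi(P).
  by apply/setIidPl; rewrite quotient_cents2.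
move=> eqPPhi; rewrite centsC; apply/setIidPl.
rewrite -[LHS]genGid; apply: Phi_nongen; apply/eqP.
rewrite eqEsubset join_subG Phi_sub subsetIl /= norm_joinEr ?(subset_trans
  (subsetIl _ _)) //.
by rewrite -quotientSK // eqPPhi.
Qed.

Section Stability.

Variables (p : nat) (gT : finGroupType).
Implicit Types G A B D K L P : {group gT}.

(** The coprime stability argument iterated along the chain: a p'-group that
    acts trivially on each factor of the p-group P, and on the bottom A, acts
    trivially on P. *)
Lemma hypercyclic_stable_cent G P A (D : {group gT}) : p.-group P -> p^'.-group D ->
    D \subset G -> A <| G -> hypercyclic G A P ->
    (forall B L : {group gT}, A \subset B -> L \subset P -> B <| G -> L <| G ->
      B \subset L ->
       cyclic (L / B) -> [~: L, D] \subset B) ->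
  D \subset 'C(A) -> D \subset 'C(P).
Proof.
move=> pP p'D sDG nsAG hAP stabD cAD.
suff: forall B, hypercyclic G A B -> B \subset P -> D \subset 'C(B) by apply.
move=> B; elim=> // {}B L hAB IH sBL nsLG cycLB sLP.
have sBP := subset_trans sBL sLP; have nsBG := hypercyclic_normal nsAG hAB.
have [_ nBG] := andP nsBG.
apply: coprime_stable_cent (stabD B L _ _ _ _ _ _) (IH sBP) => //.
- by rewrite (subset_trans sDG) ?normal_norm.
- exact: subset_trans nBG.
- exact: subset_trans (normal_sub nsLG) nBG.
- by rewrite (pnat_coprime (pgroupS sBP pP)).
- exact: pgroup_sol (pgroupS sBP pP).
exact: hypercyclic_sub hAB.
Qed.

Lemma cyclic_section_der1 G B L : B <| G -> L <| G -> cyclic (L / B) ->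
  [~: L, G^`(1)] \subset B.
Proof.
move=> /andP[_ nBG] /andP[sLG nLG] cycLB.
rewrite commGC -quotient_cents2 ?(subset_trans (der_sub 1 G)) ?(subset_trans sLG) //.
by rewrite quotient_der // cyclic_der1_cent ?quotient_norms.
Qed.

(** The quotient of G by this subgroup is its largest abelian quotient of
    exponent dividing p - 1, which is the kind of group that acts faithfully on
    a group of order p. *)
Definition exponent_residual G := <<G^`(1) :|: [set g ^+ p.-1 | g in G]>>.

Lemma exponent_residual_sub G : exponent_residual G \subset G.
Proof.
rewrite gen_subG subUset der_sub; apply/subsetP=> _ /imsetP[g Gg ->].
exact: groupX.
Qed.

Lemma exponent_residual_norm G : G \subset 'N(exponent_residual G).
Proof.
apply: norms_gen; apply: normsU; first exact: der_norm.
apply/subsetP=> h Gh; rewrite inE; apply/subsetP=> _ /imsetP[_ /imsetP[g Gg ->] ->].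
by apply/imsetP; exists (g ^ h); rewrite ?groupJ ?conjXg.
Qed.

Lemma cyclic_abelem_section_cent G (E : {group gT}) :
  cyclic E -> p.-abelem E -> G \subset 'N(E) -> exponent_residual G \subset 'C(E).
Proof.
move=> cycE abelE nEG; rewrite gen_subG subUset cyclic_der1_cent //=.
apply/subsetP=> _ /imsetP[g Gg ->].
have [-> | ntE] := eqVneq (E : {set gT}) 1; first by rewrite cent1T inE.
rewrite -(cyclic_abelem_prime abelE cycE ntE) prime_exp_cent ?(subsetP nEG) //.
rewrite (cyclic_abelem_prime abelE cycE ntE).
by have [pE _ _] := and3P abelE; case: (pgroup_pdiv pE ntE).
Qed.

End Stability.

Canonical exponent_residual_group p (gT : finGroupType) (G : {group gT}) :=
  [group of exponent_residual p G].

Section PhiLift.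

Variables (p : nat) (gT : finGroupType).
Implicit Types G E P : {group gT}.

Lemma quotient_exponent_residual G (N : {group gT}) : G \subset 'N(N) ->
  exponent_residual p G / N = exponent_residual p (G / N).
Proof.
move=> nNG; rewrite quotient_gen; last first.
  by rewrite subUset (subset_trans (der_sub _ _)) //=;
    apply/subsetP=> _ /imsetP[g Gg ->]; rewrite groupX ?(subsetP nNG).
congr <<_>>; rewrite quotientU quotient_der //; congr (_ :|: _).
apply/setP=> xb; apply/morphimP/imsetP => [[x nNx /imsetP[g Gg ->] ->] | [_
  /morphimP[g nNg Gg ->] ->]].
  exists (coset N g); first exact: mem_quotient.
  by rewrite /= morphX ?(subsetP nNG).
exists (g ^+ p.-1); rewrite ?groupX //; last by rewrite /= morphX.
by apply/imsetP; exists g.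
Qed.

(** The exponent residual centralises every factor of order 1 or p of the chain,
    hence its p'-elements centralise E. *)
Lemma abelem_hypercyclic_cent G E : p.-abelem E -> E <| G -> hypercyclic G 1 E ->
  p_residual p (exponent_residual p G) \subset 'C(E).
Proof.
move=> abelE nsEG hE; have [pE _ _] := and3P abelE.
rewrite gen_subG; apply/subsetP=> x /setIdP[Rx p'x]; rewrite -cycle_subG.
have sxR : <[x]> \subset exponent_residual p G by rewrite cycle_subG.
have sxG := subset_trans sxR (exponent_residual_sub p G).
apply: (hypercyclic_stable_cent pE p'x sxG (normal1 G) hE) => [B L _ sLE nsBG
  nsLG sBL cycLB|].
  have nBG := normal_norm nsBG.
  rewrite commGC -quotient_cents2 ?(subset_trans sxG) ?(subset_trans
    (normal_sub nsLG)) //.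
  apply: subset_trans (quotientS B sxR) _; rewrite quotient_exponent_residual //.
  apply: cyclic_abelem_section_cent; rewrite ?quotient_norms ?normal_norm //.
  exact: quotient_abelem (abelemS sLE abelE).
by rewrite cents1.
Qed.

(** A Sylow p-subgroup T of S has nontrivial fixed points in the p-group E, and
    since S = O^p(S) T they are fixed by S. They form a subgroup normalised by
    G. *)
Lemma minnormal_residual_cent G E (S : {group gT}) : prime p ->
    minnormal E G -> p.-group E -> S \subset G -> G \subset 'N(S) ->
  p_residual p S \subset 'C(E) -> S \subset 'C(E).
Proof.
move=> pr_p /mingroupP[/andP[ntE nEG] minE] pE sSG nSG cER.
have [T sylT] := Sylow_exists p S; have defS := p_residual_Sylow pr_p sylT.
have [sTS pT _] := and3P sylT.
have nET : T \subset 'N(E) := subset_trans sTS (subset_trans sSG nEG).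
have ntCT : 'C_E(T) != 1.
  have pTE : p.-group (T <*> E) by rewrite norm_joinEl // pgroupM pT.
  have nsE : E <| T <*> E by rewrite /normal joing_subr join_subG nET normG.
  have := meet_center_nil (pgroup_nil pTE) nsE ntE.
  apply: contraNneq => CT1; rewrite -subG1 -CT1 setIS //.
  by rewrite subIset // centS ?joing_subl ?orbT.
have eqC : 'C_E(T) = 'C_E(S).
  apply/eqP; rewrite eqEsubset [X in _ && X]setIS ?centS // andbT subsetI subsetIl /=.
  by rewrite -defS centM subsetI subsetIr andbT (subset_trans (subsetIl _ _)) // centsC.
rewrite centsC; apply/setIidPl/(minE 'C_E(S)%G); last exact: subsetIl.
rewrite /= -eqC ntCT /= eqC normsI //.
exact: subset_trans nSG (cent_norm _).
Qed.

End PhiLift.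

(** Let S be the exponent residual of G. By the chain, O^p(S) acts trivially on
    P / Phi(P), hence on P by coprime action. Then S centralises each chief
    factor K / L of G below P, so G acts on K / L as an abelian group of exponent
    dividing p - 1; such an action has an eigenvector, and K / L is cyclic. *)
Theorem hypercyclic_Phi_lift (p : nat) (gT : finGroupType) (G P : {group gT}) :
    prime p -> P <| G -> p.-group P -> hypercyclic G 'Phi(P) P ->
  hypercyclic G 1 P.
Proof.
move=> pr_p nsPG pP hP; have [sPG nPG] := andP nsPG.
have nsPhiG : 'Phi(P) <| G := gFnormal_trans _ nsPG.
have nPhiG := normal_norm nsPhiG.
have cPR : p_residual p (exponent_residual p G) \subset 'C(P).
  rewrite gen_subG; apply/subsetP=> x /setIdP[Rx p'x]; rewrite -cycle_subG.
  have Gx := subsetP (exponent_residual_sub p G) x Rx.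
  apply: (coprime_Phi_cent pP p'x); first by rewrite cycle_subG (subsetP nPG).
  rewrite commGC -quotient_cents2 ?gFnorm ?cycle_subG ?(subsetP nPhiG) //.
  have hPb : hypercyclic (G / 'Phi(P)) 1 (P / 'Phi(P)).
    have := hypercyclic_quotient nsPhiG nPhiG hP.
    by rewrite (_ : 'Phi(P) / 'Phi(P) = 1)%G //; apply/val_inj/trivg_quotient.
  apply: subset_trans (abelem_hypercyclic_cent (Phi_quotient_abelem pP)
    (quotient_normal _ nsPG) hPb).
  rewrite quotient_cycle ?(subsetP nPhiG) // cycle_subG; apply: mem_gen.
  rewrite inE -quotient_exponent_residual // mem_quotient //=.
  by rewrite morph_p_elt ?(subsetP nPhiG).
apply: (chief_factors_hypercyclic nsPG) => L K chKL sKP.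
have minKL := chief_factor_minnormal chKL.
have [/maxgroupp/andP[/andP[sLK _] nLG] nsKG] := andP chKL.
have pKL : p.-group (K / L) by rewrite quotient_pgroup // (pgroupS sKP).
have abelKL : p.-abelem (K / L).
  have /is_abelemP[q pr_q abelq] : is_abelem (K / L).
    by have [_ _] := minnormal_solvable minKL (subxx _) (pgroup_sol pKL).
  have ntKL : K / L != 1 by have [/andP[]] := mingroupP minKL.
  suff -> : p = q by [].
  have [pr_q' q_dvd _] := pgroup_pdiv (abelem_pgroup abelq) ntKL.
  by have := pgroupP pKL q pr_q q_dvd; rewrite !inE => /eqP.
have cent_res : exponent_residual p (G / L) \subset 'C(K / L).
  apply: (@minnormal_residual_cent p _ (G / L)%G (K / L)%G) => //.
  - exact: exponent_residual_sub.
  - exact: exponent_residual_norm.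
  rewrite /= -quotient_exponent_residual //.
  apply: subset_trans (p_residual_quotient_sub p (subset_trans
    (exponent_residual_sub p G) nLG)) _.
  by rewrite quotient_cents // (subset_trans cPR) ?centS.
apply: (minnormal_power_cyclic pr_p abelKL minKL).
  by apply: subset_trans cent_res; rewrite sub_gen ?subsetUl.
move=> g Gg; apply: (subsetP cent_res); apply: mem_gen; rewrite inE.
by apply/orP; right; apply/imsetP; exists g.
Qed.

(** * Normal p-subgroups *)

Lemma quotient_hypercyclicP (gT : finGroupType) (G N P : {group gT}) :
    N <| G -> N \subset P -> P <| G -> hypercyclic (G / N) 1 (P / N) ->
  hypercyclic G N P.
Proof.
move=> nsNG sNP nsPG /(hypercyclic_cosetpre nsNG (normal1 _)).
rewrite (_ : _ @*^-1 1 = N)%G; last by apply/val_inj/ker_coset.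
rewrite (_ : _ @*^-1 (P / N) = P)%G //; apply/val_inj/quotientGK.
exact: normalS sNP (normal_sub nsPG) nsNG.
Qed.

Section NormalPGroup.

Variables (p : nat) (gT : finGroupType) (G P : {group gT}).
Hypotheses (pr_p : prime p) (nsPG : P <| G) (pP : p.-group P).

(** The same trichotomy for a normal p-subgroup P, where M, being the
    intersection of M T with P, is itself normalised by O^p(G). *)
Definition hypercyclicity_cond (M : {group gT}) :=
  [\/ hypercyclic_supplemented G M, hypercyclically_embedded G P P M
    | p_residual p G \subset 'N(M)].

Lemma Sylow_self : p.-Sylow(P) P.
Proof. by rewrite /pHall subxx pP indexgg. Qed.

(** The Frattini subgroup of P / <v> is trivial, so some maximal subgroup of it
    avoids the image of w. *)
Lemma exists_separating_maximal v w : p.-abelem P -> v \in P -> w \in P ->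
  w \notin <[v]> -> exists M : {group gT}, [/\ maximal M P, v \in M & w \notin M].
Proof.
move=> abelP Pv Pw not_vw; have svP : <[v]> \subset P by rewrite cycle_subG.
have nvP : P \subset 'N(<[v]>) := subset_trans (abelem_abelian abelP)
  (subset_trans (centS svP) (cent_sub _)).
have nvw := subsetP nvP w Pw.
have /eqP Phi1 : 'Phi(P / <[v]>) == 1.
  by rewrite (trivg_Phi (quotient_pgroup _ pP)) quotient_abelem.
have : coset <[v]> w \notin 'Phi(P / <[v]>).
  by rewrite Phi1 inE; apply: contra not_vw => /eqP/coset_idr; apply.
rewrite /Frattini; move/bigcapP=> notPhi.
have [Mb /andP[maxMb not_Mw]] : exists Mb : {group coset_of <[v]>}, maximal_eq
  Mb (P / <[v]>) && (coset <[v]> w \notin Mb).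
  apply/existsP; apply: contraPT notPhi => /existsPn no_Mb; apply => Mb maxMb.
  by have := no_Mb Mb; rewrite maxMb /= negbK.
case/predU1P: maxMb => [defMb | maxMb].
  by case/negP: not_Mw; rewrite defMb mem_quotient.
have [M [maxM sPvM defMb]] := maximal_quotient_lift pP nvP maxMb.
exists M; split=> //; first by rewrite (subsetP sPvM) // inE Pv cycle_id.
by apply: contra not_Mw => Mw; rewrite defMb mem_quotient.
Qed.

(** A nontrivial normal subgroup Y of G inside P contains N, since otherwise N
    would embed in P / Y and would be cyclic like the chief factors there. In
    particular the core of a maximal subgroup that does not contain N is
    trivial. *)
Lemma no_noncyclic_minnormal (N : {group gT}) :
    p.-abelem P -> minnormal N G -> N \subset P -> ~~ cyclic N ->
    (forall Y : {group gT}, Y <| G -> Y \subset P -> Y :!=: 1 -> hypercyclic G Y P) ->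
    (forall M : {group gT}, maximal M P -> hypercyclicity_cond M) -> False.
Proof.
move=> abelP minN sNP ncycN hypQ condP; have [sPG nPG] := andP nsPG.
have [/andP[ntN nNG] minN_eq] := mingroupP minN.
have sNG := subset_trans sNP sPG; have nsNG : N <| G by apply/andP.
have abP := abelem_abelian abelP.
have minN_sub (Y : {group gT}) : Y <| G -> Y :&: N != 1 -> N \subset Y.
  move=> nsYG ntYN; rewrite -(minN_eq (Y :&: N)%G) ?subsetIl ?subsetIr //.
  by rewrite ntYN normsI ?normal_norm.
have uniqN (Y : {group gT}) : Y <| G -> Y \subset P -> Y :!=: 1 -> N \subset Y.
  move=> nsYG sYP ntY; apply: minN_sub => //; apply: contra ncycN => /eqP tiYN.
  apply: (hypercyclic_minnormal nsYG minN sNG (hypQ Y nsYG sYP ntY)).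
    by rewrite setIC.
  by rewrite (setIidPl sNP).
have [S sylS] := Sylow_exists p G; have [sSG pS _] := and3P sylS.
have sPS : P \subset S.
  exact: subset_trans (pcore_max pP nsPG) (pcore_sub_Hall sylS).
have nsNS : N <| S by rewrite /normal (subset_trans sNP) ?(subset_trans sSG).
have /trivgPn[v /setIP[Nv Zv] nt_v] := meet_center_nil (pgroup_nil pS) nsNS ntN.
have Pv := subsetP sNP v Nv.
have nvS : S \subset 'N(<[v]>).
  by rewrite cents_norm // centsC cycle_subG; case/setIP: Zv.
have : ~~ (p_residual p G \subset 'N(<[v]>)).
  apply: contra ncycN => nvR; suff <- : <[v]> = N by apply: cycle_cyclic.
  apply: minN_eq; last by rewrite cycle_subG.
  by rewrite cycle_eq1 nt_v -(p_residual_Sylow pr_p sylS) mul_subG.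
(* A central element v of the Sylow subgroup S spans an S-invariant line of N;
   as G = O^p(G) S, this line is moved by some x in O^p(G). *)
case/subsetPn=> x Rx not_nvx; have Gx := subsetP (p_residual_sub p G) x Rx.
have Nvx : v ^ x \in N by rewrite memJ_norm ?(subsetP nNG).
have not_vx : v ^ x \notin <[v]>.
  by apply: contra not_nvx => vx; rewrite inE -cycleJ cycle_subG.
have [M [maxM Mv not_Mvx]] := exists_separating_maximal abelP Pv (subsetP sNP _
  Nvx) not_vx.
have sMP := proper_sub (maxgroupp maxM).
have not_sNM : ~~ (N \subset M) by apply: contra not_Mvx => /subsetP->.
case: (condP M maxM) => [[T [sTG hT defG]] | [C [R [W [[nsCG nsRG sRP] [sCM hCW
  not_sPRM sMRW]]]]] | nMR].
- have defGP : P * T = G.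
    by apply/eqP; rewrite eqEsubset mul_subG //= -{1}defG mulSg.
  have not_sPTM : ~~ (P :&: T \subset M).
    have [_ not_sPM] := andP (maxgroupp maxM); apply: contra not_sPM => sPTM.
    have <- : M * (P :&: T) = P by rewrite setIC group_modl // defG (setIidPr sPG).
    by rewrite mul_subG.
  (* P :&: T is centralised by P and normalised by T, and P T = G. The same
     reasoning makes a T-invariant cyclic subgroup of N invariant under G. *)
  have nsVG : P :&: T <| G.
    rewrite /normal subIset ?sPG //= -defGP mul_subG //.
      by rewrite cents_norm // (subset_trans abP) // centS ?subsetIl.
    by rewrite normsI ?normG // (subset_trans sTG).
  have sNV : N \subset P :&: T.
    apply: (uniqN (P :&: T)%G) => //; first exact: subsetIl.
    by apply: contra not_sPTM => /eqP->; apply: sub1G.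
  have sNT : N \subset T by rewrite (subset_trans sNV) ?subsetIr.
  have nsNT : N <| T := normalS sNT sTG nsNG.
  have [|| Z [nsZT sZN cycZ ntZ]] := hypercyclic_meet (normal1 T) nsNT hT.
  - by apply/setIidPr/sub1G.
  - by rewrite (setIidPl sNT).
  case/negP: ncycN; rewrite -(minN_eq Z) //.
  rewrite ntZ /= -defGP mul_subG ?(normal_norm nsZT) //.
  by rewrite cents_norm // (subset_trans abP) // centS // (subset_trans sZN).
- have C1 : C :=: 1.
    apply/eqP; apply: contraNT not_sNM => ntC.
    by apply: subset_trans (sCM); apply: uniqN ntC; rewrite // (subset_trans sCM).
  have sNR : N \subset R.
    apply: uniqN => //; apply: contra not_sPRM => /eqP->.
    by rewrite (subset_trans (subsetIr _ _)) ?sub1G.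
  have Wv : v \in W by rewrite (subsetP sMRW) // inE Mv (subsetP sNR).
  case/negP: ncycN; apply: (hypercyclic_minnormal nsCG minN sNG hCW).
    by rewrite C1; apply/setIidPr/sub1G.
  by apply/trivgPn; exists v; rewrite // inE Nv.
by case/negP: not_Mvx; rewrite memJ_norm ?(subsetP nMR).
Qed.

End NormalPGroup.

(** By induction P / N is hypercyclically embedded for every nontrivial normal
    N, so everything turns on the bottom of P: the chain is lifted from Phi(P)
    if this is nontrivial, and otherwise goes through a minimal normal subgroup,
    which has to be cyclic. *)
Theorem normal_pgroup_hypercyclic (p : nat) (gT : finGroupType) (G P : {group gT}) :
    prime p -> P <| G -> p.-group P ->
    (~~ cyclic P -> forall M : {group gT}, maximal M P -> hypercyclicity_cond p
      G P M) ->
  hypercyclic G 1 P.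
Proof.
move=> pr_p; have [m] := ubnP #|G|.
elim: m => // m IH in gT G P * => leGm nsPG pP condP; have [sPG nPG] := andP nsPG.
have [cycP | ncycP] := boolP (cyclic P).
  apply: hypercyclic_step (hypercyclic_refl _ _) (sub1G P) nsPG _.
  exact: quotient_cyclic.
have {}condP := condP ncycP.
have ntP : P :!=: 1 by apply: contraNneq ncycP => ->; apply: cyclic1.
have hypQ (N : {group gT}) : N <| G -> N \subset P -> N :!=: 1 -> hypercyclic G N P.
  move=> nsNG sNP ntN; apply: quotient_hypercyclicP => //.
  have nNG := normal_norm nsNG; have nNP := subset_trans sPG nNG.
  apply: IH; rewrite ?quotient_normal ?quotient_pgroup //.
    by apply: leq_trans (ltn_quotient ntN (normal_sub nsNG)) _.
  move=> _ _ /(maximal_quotient_lift pP nNP)[M [maxM sPNM ->]].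
  have sMP := proper_sub (maxgroupp maxM).
  case: (condP M maxM) => [supM | embM | nMR].
  - apply: Or31; apply: (quotient_hypercyclic_supplemented nsNG _ supM).
    exact: subset_trans sMP sPG.
  - apply: Or32; exact: (quotient_hypercyclically_embedded nsPG (Sylow_self pP)
    nsNG sMP sPNM embM).
  apply: Or33; apply: subset_trans (p_residual_quotient_sub p nNG) _.
  exact: quotient_norms.
have [Phi1 | ntPhi] := eqVneq 'Phi(P) 1; last first.
  apply: (hypercyclic_Phi_lift pr_p nsPG pP); apply: (hypQ _ _ (Phi_sub P) ntPhi).
  exact: gFnormal_trans.
have abelP : p.-abelem P by rewrite -trivg_Phi ?Phi1.
have [N minN sNP] := minnormal_exists ntP nPG.
have [/andP[ntN nNG] _] := mingroupP minN.
have nsNG : N <| G by rewrite /normal (subset_trans sNP).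
have [cycN | ncycN] := boolP (cyclic N).
  apply: hypercyclic_trans (hypQ N nsNG sNP ntN).
  apply: hypercyclic_step (hypercyclic_refl _ _) (sub1G N) nsNG _.
  exact: quotient_cyclic.
by case: (no_noncyclic_minnormal pr_p nsPG pP abelP minN sNP ncycN hypQ condP).
Qed.

(** * The generalized Fitting subgroup *)

Section Quasinilpotent.

Variable gT : finGroupType.
Implicit Types D E G H J K L N R S Z : {group gT}.

Lemma chief_factorP G K H : chief_factor G K H ->
  [/\ K \subset H, G \subset 'N(K), H <| G & H \subset 'N(K)].
Proof.
case/andP=> /maxgroupp/andP[/andP[sKH _] nKG] nsHG; split=> //.
exact: subset_trans (normal_sub nsHG) nKG.
Qed.

(** Congruences between elements instead of equalities in the quotient: this
    form can be transported by conjugation and is easy to compute with. *)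
Lemma quasinilpotentP N :
  quasinilpotent N <->
  forall K H : {group gT}, chief_factor N K H -> forall x, x \in N ->
    exists2 h, h \in H & forall w, w \in H -> w ^ x * (w ^ h)^-1 \in K.
Proof.
split=> qN K H chKH x Nx; have [sKH nKN nsHN nKH] := chief_factorP chKH.
  have [h Hh eqxh] := qN K H chKH x Nx; exists h => // w Hw.
  have [[nKx nKh] nKw] := (subsetP nKN x Nx, subsetP nKH h Hh, subsetP nKH w Hw).
  have [nKwx nKwh] : w ^ x \in 'N(K) /\ w ^ h \in 'N(K) by rewrite !groupJ.
  apply: coset_idr; first by rewrite groupM // groupV.
  rewrite morphM ?groupV // morphV //= !morphJ //.
  by rewrite eqxh ?mem_quotient // mulgV.
have [h Hh eqxh] := qN K H chKH x Nx; exists h => // _ /morphimP[w nKw Hw ->].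
have [nKx nKh] := (subsetP nKN x Nx, subsetP nKH h Hh).
have [nKwx nKwh] : w ^ x \in 'N(K) /\ w ^ h \in 'N(K) by rewrite !groupJ.
have := coset_id (eqxh w Hw).
rewrite morphM ?groupV // morphV //= !morphJ // => /eqP.
by rewrite -eq_mulgV1 => /eqP.
Qed.

Lemma chief_factorJ G K H g : chief_factor G K H -> chief_factor (G :^ g) (K :^
  g) (H :^ g).
Proof.
case/andP=> maxK nsHG; apply/andP; split; last by rewrite normalJ.
have /maxgroupP[/andP[pKH nKG] maxK'] := maxK.
apply/maxgroupP; split; first by rewrite properJ pKH normJ conjSg.
move=> L /andP[pLH nLG] sKL; rewrite /= -(maxK' (L :^ g^-1)%G) /= ?conjsgKV //.
  by rewrite -(properJ _ _ g) conjsgKV pLH -(conjSg _ _ g) -normJ conjsgKV.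
by rewrite -(conjSg _ _ g) conjsgKV.
Qed.

Lemma quasinilpotentJ N g : quasinilpotent N -> quasinilpotent (N :^ g)%G.
Proof.
move=> /quasinilpotentP qN; apply/quasinilpotentP => K H chKH x Ngx.
have := chief_factorJ g^-1 chKH; rewrite /= conjsgK => chKH'.
have Nx : x ^ g^-1 \in N by rewrite -mem_conjg.
have [h Hh eqxh] := qN (K :^ g^-1)%G (H :^ g^-1)%G chKH' _ Nx.
exists (h ^ g); first by rewrite -mem_conjgV.
move=> w Hw; have := eqxh (w ^ g^-1); rewrite /= memJ_conjg => /(_ Hw).
rewrite mem_conjgV conjMg conjVg -!conjgM !mulgA.
by rewrite mulgV mul1g mulgKV [h ^ g]conjgE mulgA.
Qed.

(** Chief factors of a nilpotent group are central. *)
Lemma nilpotent_quasinilpotent N : nilpotent N -> quasinilpotent N.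
Proof.
move=> nilN K H chKH g Ng; exists 1; first exact: group1.
have [sKH nKN nsHN nKH] := chief_factorP chKH.
have /mingroupP[/andP[ntHK nHKN] minHK] := chief_factor_minnormal chKH.
have nsHKN : H / K <| N / K by apply: quotient_normal.
have ntC := meet_center_nil (quotient_nil K nilN) nsHKN ntHK.
have := minHK ((H / K) :&: 'Z(N / K))%G.
rewrite ntC subsetIl normsI ?gFnorm // => /(_ isT isT) eqHK.
move=> u; rewrite -{1}eqHK => /setIP[_ /centerP[_ cu]].
by rewrite morph1 conjg1 /conjg cu ?mem_quotient // mulKg.
Qed.

(** In a soluble group chief factors are abelian, so inner automorphisms induced
    by them are trivial and the chief factors are central. If K <= [K, N] were
    nontrivial, J = [K, N] = [J, N] would be the top of a chief factor J / L; as
    this is central, J = [J, N] <= L, which is absurd. *)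
Lemma solvable_quasinilpotent_nil N : solvable N -> quasinilpotent N -> nilpotent N.
Proof.
move=> solN /quasinilpotentP qN; apply/forall_inP=> K /subsetIP[sKN sKR].
pose J := [~: K, N]%G; have nJN : N \subset 'N(J) := commg_normr N K.
have sJN : J \subset N by rewrite commg_subr (subset_trans sKN) ?normG.
have sJJ : J \subset [~: J, N] by apply: commSg.
have nsJN : J <| N by apply/andP.
rewrite -subG1 (subset_trans sKR) // -/J subG1; apply: contraT => ntJ.
have [L maxL] : {L : {group gT} | maxnormal L J N}.
  by apply: ex_maxgroup; exists 1%G; rewrite proper1G ntJ norms1.
have chJ : chief_factor N L J by apply/andP.
have [sLJ nLN _ nLJ] := chief_factorP chJ.
have [/andP[_ not_sJL] _] := andP (maxgroupp maxL).
case/negP: not_sJL; apply: subset_trans sJJ _.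
have minJL := chief_factor_minnormal chJ.
have [_ _ /is_abelemP[q _ /abelem_abelian abJL]] := minnormal_solvable minJL
  (subxx _) (quotient_sol L (solvableS sJN solN)).
rewrite gen_subG; apply/subsetP=> _ /imset2P[w x Jw Nx ->].
have [h Jh eqxh] := qN L J chJ x Nx.
have [nLw nLh] := (subsetP nLJ w Jw, subsetP nLJ h Jh).
have -> : [~ w, x] = (w ^ x * (w ^ h)^-1) ^ w * [~ w, h].
  by rewrite /commg /conjg !invMg !invgK !mulgA !(mulgK, mulgKV).
have Lwh : [~ w, h] \in L.
  have := mem_commg (mem_quotient L Jw) (mem_quotient L Jh).
  move/commG1P: abJL => -> /set1P; rewrite -morphR // => /coset_idr; apply.
  exact: groupR.
rewrite groupM // memJ_norm ?eqxh //.
Qed.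

(** Take D maximal among the normal subgroups of E that avoid R, and S minimal
    normal in E. A conjugate of S under G that is not inside D R could be added
    to D; and these conjugates generate E. *)
Lemma minnormal_complement_exists E G R : minnormal E G -> R <| E ->
  exists D : {group gT}, [/\ D <| E, D :&: R = 1 & D * R = E].
Proof.
case/mingroupP=> /andP[ntE nEG] minE nsRE; have [sRE nRE] := andP nsRE.
have [S minS sSE] := minnormal_exists ntE (normG E).
have [/andP[ntS nSE] minS'] := mingroupP minS.
have [D /maxgroupP[/andP[nsDE /eqP tiDR] maxD] _] :
    {D : {group gT} | [max D | (D <| E) && (D :&: R == 1)] & 1%G \subset D}.
  by apply: maxgroup_exists; rewrite normal1 -subG1 subsetIl.
exists D; split=> //; have [sDE nDE] := andP nsDE.
have nDR := subset_trans sRE nDE.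
apply/eqP; rewrite eqEsubset mul_subG //= -norm_joinEr //.
have sSDR h : h \in G -> S :^ h \subset D <*> R.
  move=> Gh; have sShE : S :^ h \subset E by rewrite -(normsP nEG h Gh) conjSg.
  have nShE : E \subset 'N(S :^ h) by rewrite -(normsP nEG h Gh) normJ conjSg.
  have nDRE : E \subset 'N(D <*> R) by rewrite normsY.
  have [tiShDR | ntShDR] := eqVneq ((S :^ h) :&: (D <*> R)) 1; last first.
    have sUS : ((S :^ h) :&: (D <*> R)) :^ h^-1 \subset S.
      by rewrite sub_conjgV subsetIl.
    have nUE : E \subset 'N(((S :^ h) :&: (D <*> R)) :^ h^-1).
      by rewrite normJ -sub_conjg (normsP nEG) // normsI.
    have := minS' (((S :^ h) :&: (D <*> R)) :^ h^-1)%G;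
      rewrite /= nUE andbT => /(_ _ sUS) eqS.
    rewrite -eqS; first by rewrite conjsgKV subsetIr.
    by rewrite -subG1 sub_conjgV conjs1g subG1.
  suff eqD : D <*> S :^ h = D.
    by apply: subset_trans (joing_subl D R); rewrite -eqD joing_subr.
  apply: (maxD (D <*> S :^ h)%G); last exact: joing_subl.
  rewrite /normal join_subG sDE sShE normsY //=; apply/eqP/trivgP/subsetP=> x.
  rewrite /= norm_joinEr ?(subset_trans sShE) // => /setIP[/mulsgP[d s Dd Ss ->] Rds].
  have s1 : s \in (S :^ h) :&: (D <*> R).
    rewrite inE Ss -(groupMl _ (subsetP (joing_subl D R) d Dd)).
    exact: subsetP (joing_subr D R) _ Rds.
  move: s1 Rds; rewrite tiShDR => /set1P->; rewrite mulg1 => Rd.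
  by rewrite -tiDR inE Dd.
have eqE : <<class_support S G>> = E.
  apply: (minE <<class_support S G>>%G); last first.
    rewrite gen_subG class_supportEr; apply/bigcupsP=> h Gh.
    by rewrite -(normsP nEG h Gh) conjSg.
  rewrite norms_gen ?class_support_norm // andbT.
  apply: contra ntS; rewrite -!subG1; apply: subset_trans.
  by rewrite sub_gen // sub_class_support.
by rewrite -eqE gen_subG class_supportEr; apply/bigcupsP.
Qed.

End Quasinilpotent.

Section QuasinilpotentQuotient.

Variable gT : finGroupType.
Implicit Types D E G H J K L N R S Z : {group gT}.

(** Let J / L be a chief factor of N. In N / Z the image of J has a normal
    complement D / Z, so N = D J with J :&: D <= Z. Then D acts trivially on
    J / L: either J :&: Z <= L, and L contains [J, D], or J = (J :&: Z) L and D
    centralises Z. An element d j thus acts on J / L as j does. *)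
Lemma central_extension_quasinilpotent H N Z :
    Z <| H -> N <| H -> Z \subset N -> N \subset 'C(Z) ->
    minnormal (N / Z) (H / Z) -> quasinilpotent N.
Proof.
move=> nsZH nsNH sZN cZN minNZ; apply/quasinilpotentP => L J chJ x Nx.
have [sLJ nLN nsJN nLJ] := chief_factorP chJ; have [sJN nJN] := andP nsJN.
have nsZN : Z <| N := normalS sZN (normal_sub nsNH) nsZH.
have nZN := normal_norm nsZN; have nZJ := subset_trans sJN nZN.
have [Db [nsDb tiDJ defNb]] := minnormal_complement_exists minNZ
  (quotient_normal Z nsJN).
have [D defDb sZD nsDN] := inv_quotientN nsZN nsDb.
have [sDN nDN] := andP nsDN.
have tiJD : J :&: D \subset Z.
  rewrite -quotient_sub1 ?subIset ?nZJ // -tiDJ setIC defDb.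
  exact: quotientI.
have sNDJ : N \subset D <*> J.
  rewrite -(quotientSGK nZN) ?(subset_trans sZD) ?joing_subl //.
  by rewrite -defNb defDb mul_subG ?quotientS ?joing_subl ?joing_subr.
have sJDL : [~: J, D] \subset L.
  have sJDZ : [~: J, D] \subset J :&: Z.
    rewrite subsetI commg_subl (subset_trans sDN) //=.
    apply: subset_trans tiJD; rewrite subsetI commg_subl (subset_trans sDN) //=.
    by rewrite commg_subr (subset_trans sJN).
  have [sJZL | not_sJZL] := boolP (J :&: Z \subset L); first exact: subset_trans sJZL.
  have /maxgroupP[_ maxL] : maxnormal L J N by case/andP: chJ.
  have nJZ : N \subset 'N((J :&: Z) <*> L) by rewrite normsY // normsI.
  have sUJ : (J :&: Z) <*> L \subset J by rewrite join_subG subsetIl.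
  have defJ : (J :&: Z) <*> L = J.
    apply/eqP; rewrite eqEsubset sUJ; apply: contraT => not_sJU.
    have := maxL ((J :&: Z) <*> L)%G; rewrite /= properE sUJ not_sJU nJZ joing_subr.
    by move=> /(_ isT isT) eqL; case/negP: not_sJZL; rewrite -eqL joing_subl.
  rewrite -defJ norm_joinEr ?(subset_trans sLJ) //; last first.
    by rewrite normsI ?normG // (subset_trans sJN).
  have cJZD : [~: J :&: Z, D] = 1.
    apply/commG1P; rewrite (subset_trans (subsetIr _ _)) // centsC.
    exact: subset_trans cZN.
  by rewrite commMG cJZD ?norms1 // mul1g commg_subl (subset_trans sDN).
have := subsetP sNDJ x Nx; rewrite norm_joinEl ?(subset_trans sDN) //.
case/mulsgP=> d j Dd Jj ->; exists j => // w Jw.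
rewrite conjgM -conjVg -conjMg memJ_norm ?(subsetP nLJ) //.
rewrite conjg_mulR -mulgA -[X in X * (_ * _)]invgK -conjgE.
by rewrite memJ_norm ?groupV ?(subsetP nLJ) // (subsetP sJDL) // mem_commg.
Qed.

End QuasinilpotentQuotient.

Section GeneralizedFitting.

Variable gT : finGroupType.
Implicit Types D E G H J K L N R S Z : {group gT}.

Lemma quasinilpotent_sub_Fitting N H :
  N <| H -> quasinilpotent N -> N \subset 'F*(H)%G.
Proof.
move=> nsNH qN; rewrite /generalized_Fitting bigprodGE sub_gen //.
by apply: (bigcup_max N) => //; rewrite nsNH; apply/asboolP.
Qed.

Lemma generalized_Fitting_sub H K :
    (forall N, N <| H -> quasinilpotent N -> N \subset K) -> 'F*(H)%G \subset K.
Proof.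
move=> sNK; rewrite /generalized_Fitting bigprodGE gen_subG.
by apply/bigcupsP=> N /andP[nsNH /asboolP qN]; apply: sNK.
Qed.

Lemma generalized_Fitting_normal G H : H <| G -> 'F*(H)%G <| G.
Proof.
case/andP=> sHG nHG; have sFH : 'F*(H)%G \subset H.
  by apply: generalized_Fitting_sub => N /normal_sub.
rewrite /normal (subset_trans sFH) //; apply/subsetP=> g Gg; rewrite inE.
rewrite sub_conjg; apply: (generalized_Fitting_sub (K := ('F*(H) :^ g^-1)%G))
  => N nsNH qN /=.
rewrite -sub_conjg; apply: (quasinilpotent_sub_Fitting _ (quasinilpotentJ (g := g) qN)).
by rewrite -(normsP nHG g Gg) normalJ.
Qed.

(** Soluble quasinilpotent groups are nilpotent, and conversely. *)
Lemma solvable_generalized_Fitting H : solvable 'F*(H)%G -> 'F*(H)%G :=: 'F(H).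
Proof.
move=> solF; apply/eqP; rewrite eqEsubset; apply/andP; split.
  apply: (generalized_Fitting_sub (K := 'F(H)%G)) => N nsNH qN.
  apply: Fitting_max => //; apply: solvable_quasinilpotent_nil (qN).
  exact: solvableS (quasinilpotent_sub_Fitting nsNH qN) solF.
apply: quasinilpotent_sub_Fitting; first exact: Fitting_normal.
exact: nilpotent_quasinilpotent (Fitting_nil H).
Qed.

(** Let C = C_H(X) and Z = X :&: C. If C were not inside X, then C / Z would
    contain a minimal normal subgroup N / Z of H / Z. As X centralises C, the
    subgroup Z is central in N, so N is quasinilpotent and lies in X :&: C = Z. *)
Lemma cent_generalized_Fitting H (X := 'F*(H)%G) :
  'C_H(X) \subset X.
Proof.
have nsXH : X <| H := generalized_Fitting_normal (normal_refl H).
have [sXH nXH] := andP nsXH.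
pose C := 'C_H(X)%G; pose Z := (X :&: C)%G.
have nsCH : C <| H by rewrite /normal subsetIl normsI ?normG // (subset_trans
  nXH) ?cent_norm.
have nsZH : Z <| H by rewrite normalI.
apply: contraT => not_sCX.
have ntCZ : C / Z != 1.
  rewrite -subG1 quotient_sub1; last exact: subset_trans (normal_sub nsCH)
    (normal_norm nsZH).
  by apply: contra not_sCX => /subset_trans-> //; apply: subsetIl.
have nCZH : H / Z \subset 'N(C / Z) by rewrite quotient_norms // normal_norm.
have [Nb minNb sNCb] := minnormal_exists ntCZ nCZH.
have nsNb : Nb <| H / Z.
  have [/andP[_ nNb] _] := mingroupP minNb.
  by rewrite /normal (subset_trans sNCb) // quotientS ?normal_sub.
have [N defNb sZN nsNH] := inv_quotientN nsZH nsNb.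
have sNC : N \subset C.
  by rewrite -(quotientSGK _ (subsetIr X C)) -?defNb // (subset_trans
    (normal_sub nsNH)) ?normal_norm.
have qN : quasinilpotent N.
  apply: (@central_extension_quasinilpotent _ H N Z) => //; last by rewrite -defNb.
  rewrite (subset_trans sNC) // (subset_trans (subsetIr _ _)) // centS ?subsetIl //.
have sNX := quasinilpotent_sub_Fitting nsNH qN.
have [/andP[ntNb _] _] := mingroupP minNb.
by case/negP: ntNb; rewrite defNb /= quotientS1 // subsetI sNX.
Qed.

End GeneralizedFitting.

(** * From the Fitting subgroup to the whole subgroup *)

Section Hypercyclicity.

Variable gT : finGroupType.
Implicit Types A B D G H K L N P X : {group gT}.

(** As X is nilpotent, O_p(X) is its Sylow p-subgroup, and is normal in G. In the
    s-permutable case M = M T :&: O_p(X), so the normaliser of M contains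
    O^p(G). *)
Lemma pcore_hypercyclic p G X : prime p -> X <| G -> nilpotent X ->
  maximal_Sylow_cond G X -> hypercyclic G 1 'O_p(X).
Proof.
move=> pr_p nsXG nilX condX.
have nsPG : 'O_p(X) <| G := gFnormal_trans _ nsXG.
have pP := pcore_pgroup p X.
apply: (normal_pgroup_hypercyclic pr_p nsPG pP) => ncycP M maxM.
have [/asboolP ss|/asboolP no_ss] := boolP `[< has_supersoluble_supplement G M >].
  by apply: Or31; apply: supersoluble_supplement.
have Us := condX p _ M pr_p (nilpotent_pcore_Hall p nilX) ncycP maxM no_ss.
have [emb | [T [nsTG sPTM nMTR]]] := Us_quasinormal_cases pr_p nsPG (Sylow_self
  pP) maxM Us.
  exact: Or32.
apply: Or33; have sMP := proper_sub (maxgroupp maxM).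
have nTP : 'O_p(X) \subset 'N(T) := subset_trans (normal_sub nsPG) (normal_norm nsTG).
have -> : M :=: (M <*> T) :&: 'O_p(X).
  rewrite norm_joinEl ?(subset_trans sMP) // -group_modl //.
  by apply/eqP; rewrite eqEsubset mulG_subl mul_subG // setIC.
apply: normsI => //.
exact: subset_trans (p_residual_sub p G) (normal_norm nsPG).
Qed.

Lemma nilpotent_sub_pcores X (W : {group gT}) : nilpotent X ->
  (forall p, prime p -> 'O_p(X) \subset W) -> X \subset W.
Proof.
move=> nilX sOW; rewrite -(Sylow_gen X) gen_subG;
  apply/bigcupsP=> Q /SylowP[q pr_q sylQ].
by rewrite (nilpotent_Hall_pcore nilX sylQ) sOW.
Qed.

Lemma nilpotent_hypercyclic G X : X <| G -> nilpotent X ->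
  maximal_Sylow_cond G X -> hypercyclic G 1 X.
Proof.
move=> nsXG nilX condX.
pose W n := (\prod_(p < n | prime p) 'O_p(X))%G.
have hW n : W n <| G /\ hypercyclic G 1 (W n).
  rewrite /W; elim/big_rec: _ => [|p Z pr_p [nsZG hZ]].
    by split; [apply: normal1 | apply: hypercyclic_refl].
  have nsPG : 'O_p(X) <| G := gFnormal_trans _ nsXG.
  split; first exact: normalY.
  apply: hypercyclic_trans (pcore_hypercyclic pr_p nsXG nilX condX) _.
  have := hypercyclic_join (normal1 G) nsPG hZ.
  rewrite (_ : 1 <*> _ = 'O_p(X))%G; last by apply/val_inj; rewrite /= joing1G.
  by rewrite (_ : _ * Z = Z <*> 'O_p(X))%G //; apply/val_inj; rewrite /= joingC.
suff <- : W #|X|.+1 = X by have [] := hW #|X|.+1.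
apply/val_inj/eqP; rewrite /= eqEsubset; apply/andP; split.
  by rewrite /W bigprodGE gen_subG; apply/bigcupsP=> p _; apply: pcore_sub.
apply: nilpotent_sub_pcores nilX _ => p pr_p.
have [p_le | p_gt] := leqP p #|X|.
  rewrite /W bigprodGE sub_gen //.
  by apply: (bigcup_max (Ordinal (p_le : p < #|X|.+1))).
suff -> : 'O_p(X) = 1 by apply: sub1G.
apply/eqP; apply: contraTT p_gt => ntP; rewrite -leqNgt.
have [_ p_dvd _] := pgroup_pdiv (pcore_pgroup p X) ntP.
apply: leq_trans (dvdn_leq (cardG_gt0 _) p_dvd) _.
exact: subset_leq_card (pcore_sub p X).
Qed.

(** Chief factors of G between X and H are central, hence of prime order. *)
Lemma central_hypercyclic G X H : X <| G -> H <| G -> X \subset H ->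
  [~: H, G] \subset X -> hypercyclic G X H.
Proof.
move=> nsXG nsHG sXH sHGX; apply: quotient_hypercyclicP => //.
have nXG := normal_norm nsXG.
have cHG : H / X \subset 'C(G / X).
  by rewrite quotient_cents2 // (subset_trans (normal_sub nsHG)).
apply: chief_factors_hypercyclic => [|L K chKL sKH]; first exact: quotient_normal.
have [sLK nLG nsKG nLK] := chief_factorP chKL.
have /mingroupP[/andP[ntKL _] minKL] := chief_factor_minnormal chKL.
have /trivgPn[x Kx nt_x] := ntKL.
suff <- : <[x]> = K / L by apply: cycle_cyclic.
apply: minKL; last by rewrite cycle_subG.
rewrite cycle_eq1 nt_x cents_norm // centsC cycle_subG.
by apply: subsetP Kx; apply: quotient_cents; apply: subset_trans sKH cHG.
Qed.

(** G' acts trivially on each factor of the chain, so a subgroup K = [K, D]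
    descends along the chain to 1. *)
Lemma stable_chain_residual_eq1 G D K B : hypercyclic G 1 B -> D \subset G^`(1) ->
  K \subset [~: K, D] -> K \subset B -> K :=: 1.
Proof.
move=> hB sDG' sKD.
elim: hB => [|{}B L hAB IH sBL nsLG cycLB sKL]; first by move/trivgP.
apply: IH; apply: subset_trans sKD _.
apply: subset_trans (commgSS sKL sDG') _.
exact: cyclic_section_der1 (hypercyclic_normal (normal1 G) hAB) nsLG cycLB.
Qed.

(** The p'-elements of D act trivially on the factors of the chain, hence on P;
    so D acts on P as a p-group, in which K = [K, D] has trivial image. *)
Lemma stable_chain_residual_cent p G D K P : prime p -> p.-group P -> P <| G ->
    hypercyclic G 1 P -> D \subset G^`(1) -> K \subset D -> K \subset [~: K, D] ->
  K \subset 'C(P).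
Proof.
move=> pr_p pP nsPG hP sDG' sKD sKR; have sDG := subset_trans sDG' (der_sub 1 G).
have nPD := subset_trans sDG (normal_norm nsPG).
have sRC : p_residual p D \subset 'C(P).
  rewrite gen_subG; apply/subsetP=> x /setIdP[Dx p'x]; rewrite -cycle_subG.
  have sxD : <[x]> \subset D by rewrite cycle_subG.
  apply: (hypercyclic_stable_cent pP p'x (subset_trans sxD sDG) (normal1 G) hP);
    last exact: cents1.
  move=> B L _ _ nsBG nsLG _ cycLB; apply: subset_trans (cyclic_section_der1
    nsBG nsLG cycLB).
  by apply: commgS; apply: subset_trans sDG'.
have nilDR : nilpotent (D / p_residual p D) := pgroup_nil (p_residual_quotient D pr_p).
have nRD := normal_norm (p_residual_normal p D).
have nRK := subset_trans sKD nRD.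
apply: subset_trans sRC; rewrite -quotient_sub1 //.
have /forall_inP/(_ (K / p_residual p D)%G) := nilDR.
rewrite /= subsetI quotientS //= -quotientR ?quotientS //.
by move/(_ isT)/eqP->.
Qed.

(** A subgroup K of D = H :&: G' with K <= [K, D] centralises every Sylow
    subgroup of X, hence K <= C_H(X) <= X, and the chain below X then forces
    K = 1. So D is nilpotent and contained in F(H) <= X. As [H, G] <= D, the
    factor H / X is central in G / X. *)
Theorem hypercyclic_Fitting_extension G H X : H <| G -> X <| G ->
    nilpotent X -> 'F(H) \subset X -> X \subset H -> 'C_H(X) \subset X ->
    hypercyclic G 1 X ->
  hypercyclic G 1 H.
Proof.
move=> nsHG nsXG nilX sFX sXH sCX hX.
pose D := (H :&: G^`(1))%G; have sDG' : D \subset G^`(1) := subsetIr _ _.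
have nsDG : D <| G by rewrite normalI ?der_normal.
have nilD : nilpotent D.
  apply/forall_inP=> K /subsetIP[sKD sKR]; apply/eqP.
  apply: (stable_chain_residual_eq1 hX sDG' sKR).
  have cKX : K \subset 'C(X).
    rewrite centsC; apply: (nilpotent_sub_pcores (W := 'C(K)%G) nilX) => p pr_p.
    rewrite centsC.
    have nsPG : 'O_p(X) <| G := gFnormal_trans _ nsXG.
    have hP : hypercyclic G 1 'O_p(X).
      have := hypercyclic_setI (normal1 G) (subxx G) nsPG hX.
      rewrite (_ : 1 :&: _ = 1)%G; last by apply/val_inj/setIidPl/sub1G.
      by rewrite (_ : X :&: _ = 'O_p(X))%G //; apply/val_inj/setIidPr/pcore_sub.
    exact: stable_chain_residual_cent (pcore_pgroup p X) nsPG hP sDG' sKD sKR.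
  apply: subset_trans sCX; rewrite subsetI cKX andbT.
  exact: subset_trans sKD (subsetIl _ _).
have sDX : D \subset X.
  apply: subset_trans sFX; apply: Fitting_max => //.
  by rewrite (normalS _ (normal_sub nsHG)) ?subsetIl.
apply: hypercyclic_trans hX (central_hypercyclic nsXG nsHG sXH _).
apply: subset_trans sDX; rewrite subsetI commg_subl normal_norm //=.
by rewrite commSg ?normal_sub.
Qed.

End Hypercyclicity.

(** * Saturated formations *)

Section Formation.

Variable F : group_class.
Hypotheses (hform : formation F) (hsat : saturated F) (hU : class_sub supersoluble F).

Lemma formation_isog (aT rT : finGroupType) (G : {group aT}) (L : {group rT}) :
  G \isog L -> F G -> F L.
Proof.
case/isogP=> f _ fG FG; have [hom _] := hform.
by rewrite (_ : L = f @* G)%G; [apply: hom | apply/val_inj].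
Qed.

Lemma formation_quotient (gT : finGroupType) (G N : {group gT}) :
  G \subset 'N(N) -> F G -> F (G / N)%G.
Proof.
move=> nNG FG; have [hom _] := hform.
rewrite (_ : G / N = restrm nNG (coset N) @* G)%G; first exact: hom.
by apply/val_inj; rewrite /= morphim_restrm setIid.
Qed.

Lemma formation_quotientS (gT : finGroupType) (G N K : {group gT}) :
  N <| G -> K <| G -> N \subset K -> F (G / N)%G -> F (G / K)%G.
Proof.
move=> nsNG nsKG sNK FGN; apply: formation_isog (third_isog sNK nsNG nsKG) _.
by apply: formation_quotient FGN; rewrite quotient_norms ?normal_norm.
Qed.

(** The quotient by N C embeds in the automorphism group of N, which is cyclic, and
    N C / C is cyclic as an image of N. *)
Lemma cent_prime_quotient_supersoluble (gT : finGroupType) (G N C : {group gT}) :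
    N <| G -> C <| G -> prime #|N| -> 'C_G(N) = N <*> C ->
  supersoluble (G / C)%G.
Proof.
move=> nsNG nsCG prN defC; have [sNG nNG] := andP nsNG.
have nsNCG : N <*> C <| G by rewrite normalY.
have nCN := subset_trans sNG (normal_norm nsCG).
have cycNC : cyclic ((N <*> C) / C) by rewrite quotientYidr // quotient_cyclic
  ?prime_cyclic.
exists [:: (N <*> C) / C; G / C]%G => //=; rewrite andbT; apply/andP; split.
  apply/and3P; split; [exact: sub1G | exact: quotient_normal | exact: quotient_cyclic].
apply/and3P; split; [by rewrite quotientS ?normal_sub | exact: normal_refl |].
rewrite /= (isog_cyclic (third_isog (joing_subr N C) nsCG nsNCG)) /= -defC.
have [f injf im_f] := first_isom_loc (conj_aut N) nNG.
rewrite ker_conj_aut in f injf im_f.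
rewrite -(injm_cyclic injf) // im_f //.
by apply: cyclicS (Aut_prime_cyclic prN); apply: Aut_conj_aut.
Qed.

(** If N is not inside Phi(G), it has a complement M in G, and C = C_M(N) is
    normal in G with G / C supersoluble. As N and C intersect trivially, the
    residual of G for the formation, contained in both, is trivial. *)
Lemma saturated_formation_prime_extension (gT : finGroupType) (G N : {group gT}) :
  N <| G -> prime #|N| -> F (G / N)%G -> F G.
Proof.
move=> nsNG prN FGN; have [sNG nNG] := andP nsNG.
have [sNPhi | not_sNPhi] := boolP (N \subset 'Phi(G)).
  by apply: hsat; apply: formation_quotientS nsNG (Phi_normal G) sNPhi FGN.
have [M maxM not_sNM] : exists2 M : {group gT}, maximal M G & ~~ (N \subset M).
  apply: contraPP not_sNPhi => no_M; apply/negP; rewrite negbK.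
  apply/bigcapsP=> M /predU1P[-> // | maxM].
  by apply: contraT => not_sNM; case: no_M; exists M.
have [/andP[sMG _] maxM'] := maxgroupP maxM.
have defG : N * M = G.
  rewrite -norm_joinEr ?(subset_trans sMG) //; apply/eqP.
  rewrite eqEsubset join_subG sNG sMG; apply: contraT => not_sGNM.
  have := maxM' (N <*> M)%G; rewrite properE join_subG sNG sMG not_sGNM joing_subr.
  by move=> /(_ isT isT) eqM; case/negP: not_sNM; rewrite -eqM joing_subl.
have tiNM : N :&: M = 1.
  by have [sNM|] := prime_subgroupVti M prN; [rewrite sNM in not_sNM | rewrite setIC].
pose C := 'C_M(N)%G.
have nsCG : C <| G.
  rewrite /normal subIset ?sMG //= -defG mul_subG //.
    by rewrite cents_norm // centsC subsetIr.
  by rewrite normsI ?normG // (subset_trans (subset_trans sMG nNG)) ?cent_norm.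
have abN := cyclic_abelian (prime_cyclic prN).
have defCG : 'C_G(N) = N <*> C.
  rewrite norm_joinEr; last by rewrite cents_norm // subsetIr.
  by rewrite group_modl // defG.
have FGC : F (G / C)%G by apply/hU/(cent_prime_quotient_supersoluble nsNG nsCG
  prN defCG).
have [_ /(_ _ G)[R [nsRG FGR minR]]] := hform.
have R1 : R = 1%G.
  apply/val_inj/trivgP; rewrite /= -tiNM subsetI minR //=.
  by apply: subset_trans (minR C nsCG FGC) (subsetIl _ _).
by rewrite R1 in FGR; apply: formation_isog FGR; rewrite isog_sym quotient1_isog.
Qed.

Theorem saturated_formation_hypercyclic_extension (gT : finGroupType) (G H :
  {group gT}) :
  H <| G -> hypercyclic G 1 H -> F (G / H)%G -> F G.
Proof.
have [m] := ubnP #|G|; elim: m => // m IH in gT G H * => leGm nsHG hH FGH.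
have [H1 | ntH] := eqVneq (H :&: H) 1.
  have {}H1 : H = 1%G by apply/val_inj; rewrite -[LHS]setIid.
  by rewrite H1 in FGH; apply: formation_isog FGH; rewrite isog_sym quotient1_isog.
have tiH1 : H :&: 1 = 1 by apply/setIidPr/sub1G.
have [Z [nsZG sZH prZ]] := hypercyclic_meet_prime (normal1 G) nsHG hH tiH1 ntH.
apply: (saturated_formation_prime_extension nsZG prZ).
have ntZ : Z :!=: 1 by rewrite -cardG_gt1 prime_gt1.
apply: (IH _ (G / Z)%G (H / Z)%G).
- by apply: leq_trans (ltn_quotient ntZ (normal_sub nsZG)) _.
- exact: quotient_normal.
- exact: hypercyclic_quotient1 (normal_norm nsZG) hH.
by apply: formation_isog FGH; rewrite isog_sym third_isog.
Qed.

End Formation.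

Theorem theorem3p3 (F : group_class) (hform : formation F)
    (hsat : saturated F) (hS : S_closed F) (hU : class_sub supersoluble F)
    (gT : finGroupType) (G H : {group gT}) (hHG : H <| G)
    (hquo : F (coset_of H) (G / H)%G)
    (hmax : forall (p : nat) (P M : {group gT}),
       prime p -> p.-Sylow('F*(H)%G) P -> ~~ cyclic P -> maximal M P ->
       ~ has_supersoluble_supplement G M -> Us_quasinormal G M) :
  F gT G.
Proof.
have nsXG := generalized_Fitting_normal hHG.
have defX := solvable_generalized_Fitting (maximal_Sylow_cond_solvable nsXG hmax).
have nilX : nilpotent 'F*(H)%G by rewrite defX Fitting_nil.
have hX := nilpotent_hypercyclic nsXG nilX hmax.
apply: (saturated_formation_hypercyclic_extension hform hsat hU hHG) => //.
apply: hypercyclic_Fitting_extension hX => //.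
- by rewrite defX.
- by rewrite defX Fitting_sub.
exact: cent_generalized_Fitting.
Qed.
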